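(* Consider the distributed online problem and Algorithm 1 described in the context, under Assumptions 1, 2 and 3 stated there. Let $\kappa\in(0,1)$ and $c>1$ be constants, let $\tau_t=1/c^{t}$, $\Psi_t=\sum_{s=1}^t\tau_s$, and let $\{x_{i,t}\}$ be the sequences generated by Algorithm 1 with $$\alpha_t=\sqrt{\frac{\Psi_t}{t}},\qquad \beta_t=\frac{1}{t^{\kappa}},\qquad \gamma_t=\frac{1}{t^{1-\kappa}},\qquad \forall t\in\mathbb{N}_+ .$$ Then, for any $T\in\mathbb{N}_+$ and any comparator sequence $y_{[T]}=(y_1,\dots,y_T)\in\mathcal{X}_T$, with path-length $P_T=\sum_{t=1}^{T-1}\|y_{t+1}-y_t\|$, $$\mathrm{Net\text{-}Reg}(\{x_{i,t}\},y_{[T]})=\mathcal{O}\big(T^{\max\{\kappa,1/2\}}+T^{1/2}P_T\big),$$ $$\mathrm{Net\text{-}CCV}(\{x_{i,t}\})=\mathcal{O}\big(T^{\max\{1-\kappa/2,\,3/4\}}\big).$$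
   Context: Notation: $[n]=\{1,\dots,n\}$; $\|\cdot\|$ is the Euclidean norm (spectral norm for matrices); $\mathcal{P}_{\mathbb{X}}$ is Euclidean projection onto $\mathbb{X}$; $[\cdot]_+$ is the componentwise positive part; $\mathrm{col}(\cdot)$ is vertical concatenation; vector inequalities are componentwise. Problem. There are $n$ agents, a set $\mathbb{X}\subseteq\mathbb{R}^p$, and for each $i\in[n]$, $t\in\mathbb{N}_+$ a local loss function $f_{i,t}:\mathbb{X}\to\mathbb{R}$ and a local constraint function $g_{i,t}:\mathbb{X}\to\mathbb{R}^{m_i}$; $m=\sum_{i=1}^n m_i$. Put $f_t(x)=\frac1n\sum_{j=1}^n f_{j,t}(x)$ and $g_t(x)=\mathrm{col}(g_{1,t}(x),\dots,g_{n,t}(x))$. For each $T$ let $\mathcal{X}_T=\{(x_1,\dots,x_T): x_t\in\mathbb{X},\ g_t(x_t)\le \mathbf{0}_m\ \forall t\in[T]\}$ and $\hat{\mathcal{X}}_T=\{(x,\dots,x): x\in\mathbb{X},\ g_t(x)\le\mathbf{0}_m\ \forall t\in[T]\}$; both are assumed non-empty. Communication at time $t$ is over a directed graph $\mathcal{G}_t=([n],\mathcal{E}_t)$ with mixing matrix $W_t\in\mathbb{R}^{n\times n}$ satisfying $[W_t]_{ij}>0$ if $(j,i)\in\mathcal{E}_t$ or $i=j$, and $[W_t]_{ij}=0$ otherwise. Assumption 1. (i) $\mathbb{X}$ is convex and closed, and $\|x\|\le R(\mathbb{X})$ for all $x\in\mathbb{X}$, for a positive constant $R(\mathbb{X})$.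 (ii) All $f_{i,t}$ and $g_{i,t}$ (componentwise) are convex, and for some constant $F_1>0$: $|f_{i,t}(x)-f_{i,t}(y)|\le F_1$ and $\|g_{i,t}(x)\|\le F_1$ for all $x,y\in\mathbb{X}$, $i$, $t$. (iii) Subgradients $\partial f_{i,t}(x)\in\mathbb{R}^p$ and $\partial g_{i,t}(x)\in\mathbb{R}^{p\times m_i}$ (whose $k$-th column is a subgradient of the $k$-th component of $g_{i,t}$) exist at every $x\in\mathbb{X}$, and for some constant $F_2>0$: $\|\partial f_{i,t}(x)\|\le F_2$, $\|\partial g_{i,t}(x)\|\le F_2$ for all $x\in\mathbb{X}$, $i$, $t$. Here $\partial[g_{i,t}(x)]_+\in\mathbb{R}^{p\times m_i}$ denotes a subgradient of $x\mapsto[g_{i,t}(x)]_+$: its $k$-th column is $s_k$ times the $k$-th column of $\partial g_{i,t}(x)$, with $s_k=1$ if the $k$-th component of $g_{i,t}(x)$ is positive, $s_k=0$ if it is negative, and $s_k\in[0,1]$ if it is zero. Assumption 2. (i) There is $w\in(0,1)$ with $[W_t]_{ij}\ge w$ whenever $[W_t]_{ij}>0$. (ii) Each $W_t$ is doubly stochastic. (iii) There is an integer $B>0$ such that for all $t\in\mathbb{N}_+$ the graph $([n],\bigcup_{l=0}^{B-1}\mathcal{E}_{t+l})$ is strongly connected. Assumption 3. The threshold sequence $\{\tau_t\}$ is non-increasing. Algorithm 1 (with positive parameter sequences $\{\alpha_t\},\{\beta_t\},\{\gamma_t\},\{\tau_t\}$). Initialize $x_{i,1}\in\mathbb{X}$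 arbitrarily, $\hat x_{i,1}=x_{i,1}$, $q_{i,1}=\mathbf{0}_{m_i}$. For $t=1,2,\dots$ and each $i\in[n]$: $z_{i,t+1}=\sum_{j=1}^n[W_t]_{ij}\hat x_{j,t}$; $\omega_{i,t+1}=\partial f_{i,t}(x_{i,t})+\partial[g_{i,t}(x_{i,t})]_+\,q_{i,t}$; $x_{i,t+1}=\mathcal{P}_{\mathbb{X}}(z_{i,t+1}-\alpha_{t+1}\omega_{i,t+1})$; $q_{i,t+1}=\big[(1-\beta_{t+1}\gamma_{t+1})q_{i,t}+\gamma_{t+1}\big([g_{i,t}(x_{i,t})]_+ +(\partial[g_{i,t}(x_{i,t})]_+)^T(x_{i,t+1}-x_{i,t})\big)\big]_+$; if $\|x_{i,t+1}-\hat x_{i,t}\|\ge\tau_{t+1}$ set $\hat x_{i,t+1}=x_{i,t+1}$, else set $\hat x_{i,t+1}=\hat x_{i,t}$. Performance metrics: $\mathrm{Net\text{-}Reg}(\{x_{i,t}\},y_{[T]})=\frac1n\sum_{i=1}^n\sum_{t=1}^T f_t(x_{i,t})-\sum_{t=1}^T f_t(y_t)$ and $\mathrm{Net\text{-}CCV}(\{x_{i,t}\})=\frac1n\sum_{i=1}^n\sum_{t=1}^T\|[g_t(x_{i,t})]_+\|$. Convention: $A=\mathcal{O}(B)$ means $A\le C\,B$ for all sufficiently large $T$, where the constant $C>0$ (and the threshold on $T$) does not depend on $T$ or on the comparator sequence, but may depend on the fixed problem data and algorithm parameters. *)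

(* Defs.v *)
From HB Require Import structures.
From mathcomp Require Import all_boot all_order all_algebra.
From mathcomp Require Import all_classical all_reals all_analysis.

Set Implicit Arguments.
Unset Strict Implicit.
Unset Printing Implicit Defensive.

Import Order.TTheory GRing.Theory Num.Theory.
Import numFieldNormedType.Exports.

Local Open Scope classical_set_scope.
Local Open Scope ring_scope.

(* The library norm on ['cV[R]_p] is the maximum norm, hence the following. *)
Definition enorm (R : realType) (p : nat) (v : 'cV[R]_p) : R :=
  Num.sqrt (\sum_k v k 0 ^+ 2).

Definition specnorm (R : realType) (p q : nat) (A : 'M[R]_(p, q)) : R :=
  sup [set enorm (A *m v) | v in [set v : 'cV[R]_q | enorm v <= 1]].

Definition inner (R : realType) (p : nat) (u v : 'cV[R]_p) : R :=
  \sum_k u k 0 * v k 0.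

Definition pospart (R : realType) (p : nat) (v : 'cV[R]_p) : 'cV[R]_p :=
  map_mx (Num.max 0) v.

Definition nonpos (R : realType) (p : nat) (v : 'cV[R]_p) : Prop :=
  forall k, v k 0 <= 0.

(* A nearest point exists and is unique for nonempty closed convex [X]; the
   default value [v] is irrelevant in that case. *)
Definition eproj (R : realType) (p : nat) (X : set 'cV[R]_p) (v : 'cV[R]_p) :
    'cV[R]_p :=
  xget v [set x | X x /\ forall y, X y -> enorm (v - x) <= enorm (v - y)].

(* [h] is only meaningful on [X], so the subgradient inequality is required at
   the points of [X] only. *)
Definition is_subgradient (R : realType) (p : nat) (X : set 'cV[R]_p)
    (h : 'cV[R]_p -> R) (x s : 'cV[R]_p) : Prop :=
  forall y, X y -> h x + inner s (y - x) <= h y.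

(* Throughout, time indices range over the positive integers: the values at
   index 0 of all sequences are junk and are never used. *)

Section Problem.
Context (R : realType) (n p : nat) (m : 'I_n -> nat).
Context (X : set 'cV[R]_p).
Context (f : 'I_n -> nat -> 'cV[R]_p -> R).
Context (g : forall i : 'I_n, nat -> 'cV[R]_p -> 'cV[R]_(m i)).

Definition global_loss (t : nat) (x : 'cV[R]_p) : R :=
  n%:R^-1 * \sum_(j < n) f j t x.

Definition global_constraint (t : nat) (x : 'cV[R]_p) :
    'cV[R]_(\sum_(i < n) m i) :=
  \mxcol_(i < n) g i t x.

(* A [T]-tuple is represented by a sequence of which only the terms with index
   in {1, ..., T} matter. *)
Definition feasible (T : nat) : set (nat -> 'cV[R]_p) :=
  [set y | forall t, (1 <= t <= T)%N ->
    X (y t) /\ nonpos (global_constraint t (y t))].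

Definition static_feasible (T : nat) : set (nat -> 'cV[R]_p) :=
  [set y | exists x, [/\ X x,
    forall t, (1 <= t <= T)%N -> nonpos (global_constraint t x) &
    forall t, (1 <= t <= T)%N -> y t = x]].

Context (df : 'I_n -> nat -> 'cV[R]_p -> 'cV[R]_p).
Context (dg : forall i : 'I_n, nat -> 'cV[R]_p -> 'M[R]_(p, m i)).
Context (dgpos : forall i : 'I_n, nat -> 'cV[R]_p -> 'M[R]_(p, m i)).

Definition assumption1_set : Prop :=
  [/\ convex_set X, closed X &
      exists RX : R, 0 < RX /\ forall x, X x -> enorm x <= RX].

Definition assumption1_functions : Prop :=
  [/\ forall i t, (0 < t)%N -> convex_function X (f i t),
      forall i t k, (0 < t)%N -> convex_function X (fun x => g i t x k 0) &
      exists F1 : R, 0 < F1 /\ forall i t, (0 < t)%N ->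
        (forall x y, X x -> X y -> `|f i t x - f i t y| <= F1) /\
        (forall x, X x -> enorm (g i t x) <= F1)].

Definition assumption1_subgradients : Prop :=
  [/\ forall i t x, (0 < t)%N -> X x ->
        is_subgradient X (f i t) x (df i t x),
      forall i t x k, (0 < t)%N -> X x ->
        is_subgradient X (fun y => g i t y k 0) x (col k (dg i t x)) &
      exists F2 : R, 0 < F2 /\ forall i t x, (0 < t)%N -> X x ->
        enorm (df i t x) <= F2 /\ specnorm (dg i t x) <= F2].

Definition pospart_subgradients : Prop :=
  forall i t x, (0 < t)%N -> X x -> forall k, exists s : R,
    [/\ col k (dgpos i t x) = s *: col k (dg i t x),
        0 < g i t x k 0 -> s = 1,
        g i t x k 0 < 0 -> s = 0 &
        g i t x k 0 = 0 -> 0 <= s <= 1].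

Definition assumption1 : Prop :=
  [/\ assumption1_set, assumption1_functions,
      assumption1_subgradients & pospart_subgradients].

(* [E t j i] means that [(j, i)] is an edge of the graph at time [t]. *)
Definition mixing (E : nat -> rel 'I_n) (W : nat -> 'M[R]_n) : Prop :=
  forall t i j, (0 < t)%N ->
    if E t j i || (i == j) then 0 < W t i j : Prop else W t i j = 0.

Definition doubly_stochastic (A : 'M[R]_n) : Prop :=
  [/\ forall i j, 0 <= A i j,
      forall i, \sum_j A i j = 1 &
      forall j, \sum_i A i j = 1].

Definition assumption2 (E : nat -> rel 'I_n) (W : nat -> 'M[R]_n) : Prop :=
  [/\ exists w : R, 0 < w < 1 /\
        forall t i j, (0 < t)%N -> 0 < W t i j -> w <= W t i j,
      forall t, (0 < t)%N -> doubly_stochastic (W t) &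
      exists B : nat, (0 < B)%N /\ forall t, (0 < t)%N ->
        forall i j, connect [rel u v | [exists l : 'I_B, E (t + l)%N u v]] i j].

Definition assumption3 (tau : nat -> R) : Prop :=
  forall s t, (0 < s <= t)%N -> tau t <= tau s.

Record algorithm_run (W : nat -> 'M[R]_n) (alpha beta gamma tau : nat -> R)
    (x xhat z omega : 'I_n -> nat -> 'cV[R]_p)
    (q : forall i : 'I_n, nat -> 'cV[R]_(m i)) : Prop := AlgorithmRun {
  run_init_x : forall i, X (x i 1%N);
  run_init_xhat : forall i, xhat i 1%N = x i 1%N;
  run_init_q : forall i, q i 1%N = 0;
  run_z : forall i t, (0 < t)%N ->
    z i t.+1 = \sum_(j < n) W t i j *: xhat j t;
  run_omega : forall i t, (0 < t)%N ->
    omega i t.+1 = df i t (x i t) + dgpos i t (x i t) *m q i t;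
  run_x : forall i t, (0 < t)%N ->
    x i t.+1 = eproj X (z i t.+1 - alpha t.+1 *: omega i t.+1);
  run_q : forall i t, (0 < t)%N ->
    q i t.+1 = pospart ((1 - beta t.+1 * gamma t.+1) *: q i t +
      gamma t.+1 *: (pospart (g i t (x i t)) +
                     (dgpos i t (x i t))^T *m (x i t.+1 - x i t)));
  run_xhat : forall i t, (0 < t)%N ->
    xhat i t.+1 =
      if tau t.+1 <= enorm (x i t.+1 - xhat i t) then x i t.+1 else xhat i t
}.

Definition net_reg (x : 'I_n -> nat -> 'cV[R]_p) (y : nat -> 'cV[R]_p)
    (T : nat) : R :=
  n%:R^-1 * (\sum_(i < n) \sum_(1 <= t < T.+1) global_loss t (x i t))
  - \sum_(1 <= t < T.+1) global_loss t (y t).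

Definition net_ccv (x : 'I_n -> nat -> 'cV[R]_p) (T : nat) : R :=
  n%:R^-1 * (\sum_(i < n) \sum_(1 <= t < T.+1)
               enorm (pospart (global_constraint t (x i t)))).

End Problem.

Definition path_length (R : realType) (p : nat) (y : nat -> 'cV[R]_p)
    (T : nat) : R :=
  \sum_(1 <= t < T) enorm (y t.+1 - y t).

(* Main.v *)
Require Import Defs.
From mathcomp Require Import all_boot all_order all_algebra.
From mathcomp Require Import all_classical all_reals all_analysis.
From mathcomp Require Import ring lra zify.

Set Implicit Arguments.
Unset Strict Implicit.
Unset Printing Implicit Defensive.

Import Order.TTheory GRing.Theory Num.Theory.
Import numFieldNormedType.Exports.

Local Open Scope classical_set_scope.
Local Open Scope ring_scope.

(* Write [eps_(i,t) = x_(i,t+1) - z_(i,t+1)]. Expanding the projection and the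
   dual update against a comparator [y] and a multiplier [mu >= 0] gives a
   per-step inequality whose right-hand side contains, besides telescoping
   terms, a negative term [- |eps|^2 / (2 alpha)] and the movement
   [|x_(i,t+1) - x_(i,t)|]. The movement and the disagreement between agents are
   both bounded, after summation over time, by the sum of the [|eps|]
   (products of [n B] consecutive mixing matrices contract the deviation from
   the mean), and Young's inequality absorbs them into the negative term at the
   price [J^2 alpha / 2]. Every multiplier is taken to be the constant vector
   [N]: [N = 0] yields the regret bound, and [N = T^(1 - E)], where [E] is the
   exponent of the violation bound, balances [N^2 T^(1 - kappa)] and
   [N^2 T^(1/2)] against the trivial bound [O(T)] on the negative regret. *)

(** * Euclidean geometry *)

(** The obstacle is that [q] need not stay bounded: only [beta t * |q|] is controlled, so [q], and
    with it the direction [omega], may grow like [t ^ kappa]. The customary estimate through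
    [alpha * |omega| ^ 2] is then too weak for the regret rate. The escape is that the dual update
    uses the constraint linearized towards the new iterate: the product of [q] with this
    linearization is exactly the term that the primal inequality produces, and the two cancel. What
    remains is the movement, with a coefficient that depends on [F2] and [N] but not on [q]; it is
    never estimated by the length of [omega]. A multiplier with equal entries suffices because the
    sum of the entries of a nonnegative vector dominates its Euclidean norm. It need not point along
    the violation, and one [N] serves all agents. Each agent's loss and constraint are controlled at
    its own iterate only, whereas the metrics evaluate them at every agent's iterate. The weight [K]
    on the disagreement pays for this change of point. *)

Section Euclidean.
Context (R : realType) (p : nat).
Implicit Types (u v w x y : 'cV[R]_p) (a : R).

Lemma innerC u v : inner u v = inner v u.
Proof. by apply: eq_bigr => k _; rewrite mulrC. Qed.

Lemma innerDl u v w : inner (u + v) w = inner u w + inner v w.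
Proof. by rewrite -big_split; apply: eq_bigr => k _; rewrite mxE mulrDl. Qed.

Lemma innerZl a u v : inner (a *: u) v = a * inner u v.
Proof. by rewrite mulr_sumr; apply: eq_bigr => k _; rewrite mxE mulrA. Qed.

Lemma innerDr u v w : inner w (u + v) = inner w u + inner w v.
Proof. by rewrite innerC innerDl !(innerC w). Qed.

Lemma innerZr a u v : inner u (a *: v) = a * inner u v.
Proof. by rewrite innerC innerZl innerC. Qed.

Lemma innerNl u v : inner (- u) v = - inner u v.
Proof. by rewrite -scaleN1r innerZl mulN1r. Qed.

Lemma innerNr u v : inner u (- v) = - inner u v.
Proof. by rewrite innerC innerNl innerC. Qed.

Lemma inner0l u : inner 0 u = 0.
Proof. by rewrite -(scale0r 0) innerZl mul0r. Qed.

Lemma inner_suml (I : finType) (F : I -> 'cV[R]_p) u :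
  inner (\sum_i F i) u = \sum_i inner (F i) u.
Proof.
by elim/big_rec2: _ => [|i a b _ <-]; rewrite ?inner0l ?innerDl.
Qed.

Definition innerE := (innerDl, innerDr, innerNl, innerNr, innerZl, innerZr).

Lemma sum_sqr_ge0 u : 0 <= \sum_k u k 0 ^+ 2.
Proof. by apply: sumr_ge0 => k _; exact: sqr_ge0. Qed.

Lemma enorm_ge0 u : 0 <= enorm u.
Proof. exact: sqrtr_ge0. Qed.

Lemma sqr_enorm u : enorm u ^+ 2 = \sum_k u k 0 ^+ 2.
Proof. exact/sqr_sqrtr/sum_sqr_ge0. Qed.

Lemma inner_self u : inner u u = enorm u ^+ 2.
Proof. by rewrite sqr_enorm; apply: eq_bigr => k _; rewrite expr2. Qed.

Lemma enorm0 : enorm (0 : 'cV[R]_p) = 0.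
Proof.
by rewrite /enorm big1 ?sqrtr0// => k _; rewrite mxE expr0n.
Qed.

Lemma enorm_eq0 u : enorm u = 0 -> u = 0.
Proof.
move=> u0; apply/colP => k; rewrite mxE; apply/eqP; rewrite -sqrf_eq0.
have /eqP := sqr_enorm u; rewrite u0 expr0n/= eq_sym psumr_eq0 => [/allP|j _].
  by apply; rewrite mem_index_enum.
exact: sqr_ge0.
Qed.

Lemma enormZ a u : enorm (a *: u) = `|a| * enorm u.
Proof.
rewrite /enorm -sqrtr_sqr -sqrtrM ?sqr_ge0// mulr_sumr; congr Num.sqrt.
by apply: eq_bigr => k _; rewrite mxE exprMn.
Qed.

Lemma enormN u : enorm (- u) = enorm u.
Proof. by rewrite -scaleN1r enormZ normrN1 mul1r. Qed.

Lemma enorm_distC u v : enorm (u - v) = enorm (v - u).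
Proof. by rewrite -enormN opprB. Qed.

(** Expanding the square of [enorm v *: u - enorm u *: v] gives [2 |u| |v| (|u| |v| - inner u v)];
    the factor in front is positive once both norms are nonzero. *)
Lemma inner_le u v : inner u v <= enorm u * enorm v.
Proof.
have [u0|u_neq0] := eqVneq (enorm u) 0.
  by rewrite u0 (enorm_eq0 u0) inner0l mul0r.
have [v0|v_neq0] := eqVneq (enorm v) 0.
  by rewrite v0 (enorm_eq0 v0) innerC inner0l mulr0.
have uv_gt0 : 0 < enorm u * enorm v.
  by rewrite mulr_gt0// lt_neqAle eq_sym ?u_neq0 ?v_neq0 enorm_ge0.
have := sqr_ge0 (enorm (enorm v *: u - enorm u *: v)).
rewrite -inner_self !innerE !inner_self (innerC v u) => h.
rewrite -subr_ge0 -(pmulr_rge0 _ uv_gt0); lra.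
Qed.

Lemma sqr_enormD u v :
  enorm (u + v) ^+ 2 = enorm u ^+ 2 + 2 * inner u v + enorm v ^+ 2.
Proof. by rewrite -!inner_self !innerE (innerC v u); ring. Qed.

Lemma ler_enormD u v : enorm (u + v) <= enorm u + enorm v.
Proof.
rewrite -(@ler_pXn2r _ 2) ?nnegrE ?addr_ge0 ?enorm_ge0//.
by rewrite sqr_enormD; have := inner_le u v; lra.
Qed.

Lemma ler_enormB u v : enorm (u - v) <= enorm u + enorm v.
Proof. by rewrite -[enorm v]enormN; exact: ler_enormD. Qed.

Lemma ler_enorm_sum (I : finType) (F : I -> 'cV[R]_p) :
  enorm (\sum_i F i) <= \sum_i enorm (F i).
Proof.
elim/big_rec2: _ => [|i a b _ h]; first by rewrite enorm0.
exact: le_trans (ler_enormD _ _) (lerD _ h).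
Qed.

Lemma ler_dist_enormD u v w : enorm (u - w) <= enorm (u - v) + enorm (v - w).
Proof. by rewrite -(subrKA v); exact: ler_enormD. Qed.

Lemma enorm_mono u v : (forall k, `|u k 0| <= `|v k 0|) -> enorm u <= enorm v.
Proof.
move=> uv; apply: ler_wsqrtr; apply: ler_sum => k _.
by rewrite -real_normK ?num_real// -[leRHS]real_normK ?num_real// ler_pXn2r// nnegrE.
Qed.

Lemma ler_sqr_dist_enorm x u v (r : R) :
  enorm (x - u) <= r -> enorm (x - v) <= r ->
  enorm (x - u) ^+ 2 <= enorm (x - v) ^+ 2 + 2 * r * enorm (u - v).
Proof.
move=> xu xv; have := ler_dist_enormD x v u; rewrite (enorm_distC v u).
by move: (enorm_ge0 (x - u)) (enorm_ge0 (x - v)) (enorm_ge0 (u - v)); nra.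
Qed.

End Euclidean.

Lemma inner_mulmx (R : realType) (p q : nat) (A : 'M[R]_(p, q)) u v :
  inner (A *m u) v = inner u (A^T *m v).
Proof.
have innerE (r : nat) (a b : 'cV[R]_r) : inner a b = (a^T *m b) 0 0.
  by rewrite mxE; apply: eq_bigr => k _; rewrite mxE.
by rewrite !innerE trmx_mul mulmxA.
Qed.

Lemma specnorm_le (R : realType) (p q : nat) (A : 'M[R]_(p, q)) (c : R) :
  specnorm A <= c -> forall v, enorm (A *m v) <= c * enorm v.
Proof.
move=> Ac v; have mulmx_sum_col (w : 'cV[R]_q) : A *m w = \sum_k w k 0 *: col k A.
  apply/colP => i; rewrite mxE summxE; apply: eq_bigr => k _.
  by rewrite !mxE mulrC.
have [v0|v_neq0] := eqVneq (enorm v) 0.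
  by rewrite v0 (enorm_eq0 v0) mulmx0 enorm0 mulr0.
have v_gt0 : 0 < enorm v by rewrite lt_neqAle eq_sym v_neq0 enorm_ge0.
rewrite -ler_pdivrMr//.
have -> : enorm (A *m v) / enorm v = enorm (A *m ((enorm v)^-1 *: v)).
  by rewrite -scalemxAr enormZ ger0_norm ?invr_ge0 ?enorm_ge0// mulrC.
apply: le_trans Ac; apply: ub_le_sup; last first.
  exists ((enorm v)^-1 *: v) => //=.
  by rewrite enormZ ger0_norm ?invr_ge0 ?enorm_ge0// mulVf.
(* [sup] dominates its members only on a bounded set. On the unit ball each coordinate is at most 1
   in absolute value, so the column norms add up to a bound. *)
exists (\sum_k enorm (col k A)) => _ [w /= w1 <-].
rewrite mulmx_sum_col; apply: le_trans (ler_enorm_sum _) _.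
apply: ler_sum => k _; rewrite enormZ ler_piMl ?enorm_ge0//.
apply: le_trans w1; rewrite -sqrtr_sqr; apply: ler_wsqrtr.
by rewrite (bigD1 k)//= lerDl; apply: sumr_ge0 => j _; exact: sqr_ge0.
Qed.

(** * Projection onto a bounded closed convex set *)

Section Projection.
Context (R : realType) (p : nat) (X : set 'cV[R]_p).
Context (X_neq0 : X !=set0) (X_convex : convex_set X) (X_closed : closed X).
Context (r : R).
Context (X_bounded : forall x, X x -> enorm x <= r).

Lemma nearest_point_ex v :
  exists x, X x /\ forall y, X y -> enorm (v - x) <= enorm (v - y).
Proof.
(* [EVT_min_rV] speaks of row vectors, so the set is transposed; the squared distance is then
   minimized over the compact set [A]. *)
pose A := [set u : 'rV[R]_p | X u^T].
have trmx_cont : continuous (@trmx R 1 p).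
  move=> u B [P nbhsP PB]; exists (fun i k => P k i) => [i k|w /= Pw].
    by have := nbhsP k i; rewrite mxE.
  by apply: PB => i k; rewrite mxE; exact: Pw.
have A_compact : compact A.
  apply: bounded_closed_compact; last first.
    by apply: preimage_closed => // u _; exact: trmx_cont.
  (* Boundedness is meant in the maximum norm, which is at most the Euclidean one. *)
  exists r; split; first exact: num_real.
  move=> s rs u Au; rewrite {1}/Num.norm/= mx_normrE; apply: bigmax_le => [|[i j] _].
    by apply: ltW; apply: le_lt_trans rs; apply: le_trans (X_bounded Au); exact: enorm_ge0.
  rewrite (le_trans _ (ltW rs))// (le_trans _ (X_bounded Au))//.
  rewrite -sqrtr_sqr; apply: ler_wsqrtr; rewrite (bigD1 j)//= mxE ord1 lerDl.
  by apply: sumr_ge0 => k _; exact: sqr_ge0.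
have A_neq0 : A !=set0 by case: X_neq0 => x Xx; exists x^T; rewrite /A/= trmxK.
pose F (u : 'rV[R]_p) := \sum_k (v k 0 - u 0 k) ^+ 2.
have F_cont : {within A, continuous F}.
  apply: continuous_subspaceT; apply: continuous_big; first exact: add_continuous.
  move=> k _; have cont_k : continuous (fun u : 'rV[R]_p => v k 0 - u 0 k).
    by move=> u; apply: continuousB; [exact: cst_continuous|exact: coord_continuous].
  by move=> u; apply: (continuousM (cont_k u) (cont_k u)).
have FE (w : 'cV[R]_p) : F w^T = \sum_k (v - w) k 0 ^+ 2.
  by apply: eq_bigr => k _; rewrite !mxE.
have [u Au minu] := EVT_min_rV A_neq0 A_compact F_cont.
exists u^T; split; first by move: Au; rewrite inE.
move=> y Xy; apply: ler_wsqrtr; rewrite -!FE trmxK.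
by apply: minu; rewrite inE /A/= trmxK.
Qed.

Lemma eproj_in v : X (eproj X v).
Proof. by rewrite /eproj; case: xgetP => [x _ []//|/=]; have [y hy] := nearest_point_ex v; move=> /(_ y). Qed.

Lemma eproj_min v y : X y -> enorm (v - eproj X v) <= enorm (v - y).
Proof.
rewrite /eproj; case: xgetP => [x _ [_ xmin] /xmin//|/=].
by have [x hx] := nearest_point_ex v; move=> /(_ x).
Qed.

Lemma eproj_obtuse v y : X y -> inner (v - eproj X v) (y - eproj X v) <= 0.
Proof.
move=> Xy; set x := eproj X v; rewrite leNgt; apply/negP => h_gt0.
set h := inner _ _ in h_gt0; pose d := enorm (y - x) ^+ 2.
have segment (s : R) : 0 <= s <= 1 -> 2 * s * h <= s ^+ 2 * d.
  case/andP=> s_ge0 s_le1; have Xw : X (x + s *: (y - x)).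
    have := @X_convex y x (Itv01 s_ge0 s_le1) (mem_set Xy) (mem_set (eproj_in v)).
    rewrite inE; congr X; change (s *: y + (1 - s) *: x = x + s *: (y - x)).
    by rewrite scalerBl scale1r scalerBr addrCA.
  have := eproj_min v Xw; rewrite -/x -(@ler_pXn2r _ 2) ?nnegrE ?enorm_ge0//.
  rewrite opprD addrA (sqr_enormD (v - x)) enormN innerNr innerZr enormZ exprMn.
  rewrite real_normK ?num_real// -/h -/d; lra.
have d_ge0 : 0 <= d by exact: sqr_ge0.
(* This step length [s] lies in [[0, 1]] even if [d = 0], and it turns [2 s h - s^2 d] into
   [s^2 (2 h + d)], which is positive. *)
have := segment (h / (h + d)); rewrite divr_ge0 ?addr_ge0 ?(ltW h_gt0)//=.
have hd_gt0 : 0 < h + d by rewrite ltr_wpDr.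
rewrite ler_pdivrMr// mul1r lerDl d_ge0 => /(_ isT).
rewrite leNgt => /negP; apply.
rewrite -subr_gt0 (_ : _ - _ = (h / (h + d)) ^+ 2 * (2 * h + d)); last first.
  by field; rewrite gt_eqF.
by rewrite mulr_gt0 ?exprn_gt0 ?divr_gt0// ltr_wpDr// mulr_gt0.
Qed.

(** Expand [z - y = (z - x) + (x - y)] at the projected point [x] and use the obtuse angle there.
    The square of [x - z] is kept because it later absorbs movement and disagreement. *)
Lemma eproj_step z w y (a : R) : X y ->
  enorm (eproj X (z - a *: w) - y) ^+ 2 <=
    enorm (z - y) ^+ 2 - enorm (eproj X (z - a *: w) - z) ^+ 2
    - 2 * a * inner w (eproj X (z - a *: w) - y).
Proof.
move=> /(eproj_obtuse (z - a *: w)); set x := eproj _ _.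
rewrite (_ : z - a *: w - x = (z - x) - a *: w); last by rewrite addrAC.
have -> : z - y = (z - x) + (x - y) by rewrite subrKA.
rewrite (sqr_enormD (z - x)) (enorm_distC x z) -(opprB x y) !innerE; lra.
Qed.

End Projection.

(** * Consensus *)

Section DoublyStochastic.
Context (R : realType) (n : nat).
Implicit Types (A B : 'M[R]_n).

Lemma doubly_stochastic1 : doubly_stochastic (1%:M : 'M[R]_n).
Proof.
split=> [i j|i|j]; first by rewrite mxE ler0n.
- rewrite (bigD1 i)//= big1 => [|j ji]; rewrite mxE ?eqxx ?addr0//.
  by rewrite eq_sym (negbTE ji).
- rewrite (bigD1 j)//= big1 => [|i ij]; rewrite mxE ?eqxx ?addr0//.
  by rewrite (negbTE ij).
Qed.

Lemma doubly_stochasticM A B :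
  doubly_stochastic A -> doubly_stochastic B -> doubly_stochastic (A *m B).
Proof.
move=> [A0 Ar Ac] [B0 Br Bc]; split=> [i j|i|j].
- by rewrite mxE sumr_ge0// => k _; rewrite mulr_ge0.
- under eq_bigr do rewrite mxE; rewrite exchange_big/= -[RHS](Ar i).
  by apply: eq_bigr => k _; rewrite -mulr_sumr Br mulr1.
- under eq_bigr do rewrite mxE; rewrite exchange_big/= -[RHS](Bc j).
  by apply: eq_bigr => k _; rewrite -mulr_suml Ac mul1r.
Qed.

(** The newest factor stands on the left, so the matrix carries the states at time [t] to those at
    time [t + l] when mixing is undisturbed. *)
Fixpoint transition (W : nat -> 'M[R]_n) (t l : nat) : 'M[R]_n :=
  if l is l'.+1 then W (t + l')%N *m transition W t l' else 1%:M.

Lemma transition_doubly_stochastic (W : nat -> 'M[R]_n) t l : (0 < t)%N ->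
  (forall s, (0 < s)%N -> doubly_stochastic (W s)) ->
  doubly_stochastic (transition W t l).
Proof.
move=> t0 Wds; elim: l => [|l IHl] /=; first exact: doubly_stochastic1.
by apply: doubly_stochasticM => //; apply: Wds; rewrite addn_gt0 t0.
Qed.

End DoublyStochastic.

(** * Entrywise positivity of long products of mixing matrices *)

Section Positivity.
Context (R : realType) (n : nat) (E : nat -> rel 'I_n) (W : nat -> 'M[R]_n).
Context (EW : mixing E W) (Wds : forall t, (0 < t)%N -> doubly_stochastic (W t)).
Context (w : R) (w_gt0 : 0 < w).
Context (Ww : forall t i j, (0 < t)%N -> 0 < W t i j -> w <= W t i j).

(* Row indices at which column [j] of the transition matrix is at least [w ^ l];
   connectivity over [B] steps makes this set grow until it is full. *)
Let heavy t j l : {set 'I_n} := [set i | w ^+ l <= transition W t l i j]%SET.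

(** The single term [k = u] of the matrix product already supplies one more factor [w], and the
    other terms are nonnegative. The case [u == v] rests on the positive diagonal and keeps the sets
    from shrinking. *)
Let heavy_edge t j l u v : (0 < t)%N -> E (t + l)%N u v || (u == v) ->
  u \in heavy t j l -> v \in heavy t j l.+1.
Proof.
move=> t0 uv; rewrite !inE => uS /=; rewrite mxE (bigD1 u)//=.
have tl0 : (0 < t + l)%N by rewrite addn_gt0 t0.
have := EW v u tl0; rewrite eq_sym uv => Wvu.
rewrite exprS; apply: (@le_trans _ _ (W (t + l)%N v u * transition W t l u j)).
  by rewrite ler_pM ?exprn_ge0 ?(ltW w_gt0)// Ww.
rewrite lerDl sumr_ge0// => k _; have [W0 _ _] := Wds tl0.
by rewrite mulr_ge0//; have [] := transition_doubly_stochastic l t0 Wds.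
Qed.

Let heavyS t j l k : (0 < t)%N -> heavy t j l \subset heavy t j (l + k).
Proof.
move=> t0; elim: k => [|k IHk]; first by rewrite addn0.
apply: fintype.subset_trans IHk _; apply/fintype.subsetP => u uS; rewrite addnS.
by apply: (heavy_edge t0 _ uS); rewrite eqxx orbT.
Qed.

Context (B : nat).
Context (connected : forall t, (0 < t)%N -> forall i j,
  connect [rel u v | [exists l : 'I_B, E (t + l)%N u v]] i j).

(** If [B] steps add no index, the set is constant over the window and hence closed under every edge
    occurring in it. Following a path from [j] then reaches every index. *)
Let heavy_grow t j l : (0 < t)%N -> j \in heavy t j l ->
  heavy t j l != finset.setT -> (#|heavy t j l| < #|heavy t j (l + B)|)%N.
Proof.
move=> t0 jS; apply: contraNT; rewrite -leqNgt => card_le.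
have SE : heavy t j l = heavy t j (l + B).
  by apply/eqP; rewrite eqEcard card_le heavyS.
have closedS u v : [exists b : 'I_B, E (t + l + b)%N u v] ->
    u \in heavy t j l -> v \in heavy t j l.
  move=> /existsP[b Euv] uS; rewrite SE.
  have /fintype.subsetP/(_ u uS) ub := heavyS j l b t0.
  have -> : (l + B = (l + b).+1 + (B - b.+1))%N.
    by rewrite addSnnS subnSK// -addnA subnKC// ltnW.
  have /fintype.subsetP := heavyS j (l + b).+1 (B - b.+1) t0; apply.
  by apply: (heavy_edge t0 _ ub); rewrite addnA Euv.
apply/eqP/setP => i; rewrite [RHS]inE.
have tl0 : (0 < t + l)%N by rewrite addn_gt0 t0.
have path_closed s v : path [rel u v | [exists b : 'I_B, E (t + l + b)%N u v]] v s ->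
    v \in heavy t j l -> last v s \in heavy t j l.
  by elim: s v => //= u s IHs v /andP[vu us] vS; apply: IHs us _; exact: closedS vu vS.
have /connectP[r js ir] := connected tl0 j i; rewrite ir; exact: path_closed js jS.
Qed.

Lemma transition_pos : (0 < n)%N -> exists (L : nat) (eta : R), 0 < eta /\
  forall t i j, (0 < t)%N -> eta <= transition W t L i j.
Proof.
(* The set starts with [j] and each window of [B] steps adds at least one index until all [n] are
   present, so [n] windows suffice. *)
move=> n_gt0; exists (n * B)%N, (w ^+ (n * B)); split; first exact: exprn_gt0.
move=> t i j t0.
have j0 l : j \in heavy t j l.
  have := heavyS j 0 l t0; move=> /fintype.subsetP; apply.
  by rewrite inE/= mxE eqxx expr0.
have card_ge k : (minn n k.+1 <= #|heavy t j (k * B)|)%N.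
  elim: k => [|k IHk].
    by rewrite (leq_trans (geq_minr _ _))// card_gt0; apply/set0Pn; exists j.
  rewrite mulSn addnC; have [full|not_full] := eqVneq (heavy t j (k * B)) finset.setT.
    rewrite (leq_trans (geq_minl _ _))//.
    have := subset_leq_card (heavyS j (k * B) B t0).
    by rewrite full cardsT card_ord.
  by move: IHk (heavy_grow t0 (j0 _) not_full); lia.
have : heavy t j (n * B) == finset.setT.
  rewrite eqEcard finset.subsetT cardsT card_ord.
  by rewrite (leq_trans _ (card_ge n))// leq_min leqnn leqnSn.
by move=> /eqP/setP/(_ i); rewrite !inE.
Qed.

End Positivity.

(** * Deviation from the mean under mixing *)

Section Consensus.
Context (R : realType) (n p : nat) (n_gt0 : (0 < n)%N).
Implicit Types (x y d : 'I_n -> 'cV[R]_p).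

Definition mean x : 'cV[R]_p := n%:R^-1 *: \sum_i x i.

Definition deviation x : R := \sum_i enorm (x i - mean x).

Lemma deviation_ge0 x : 0 <= deviation x.
Proof. by apply: sumr_ge0 => i _; exact: enorm_ge0. Qed.

Let n_neq0 : n%:R != 0 :> R. Proof. by rewrite pnatr_eq0 -lt0n. Qed.

Lemma sum_sub_mean x : \sum_i (x i - mean x) = 0.
Proof.
rewrite sumrB sumr_const card_ord -scaler_nat /mean scalerA mulfV//.
by rewrite scale1r subrr.
Qed.

Lemma meanD x y : mean (fun i => x i + y i) = mean x + mean y.
Proof. by rewrite /mean big_split scalerDr. Qed.

Lemma sum_enorm_mean d : \sum_(i < n) enorm (mean d) <= \sum_i enorm (d i).
Proof.
rewrite sumr_const card_ord -mulr_natr enormZ ger0_norm ?invr_ge0//.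
rewrite mulrC mulrA mulfV// mul1r; exact: ler_enorm_sum.
Qed.

Lemma deviationD x d :
  deviation (fun i => x i + d i) <= deviation x + 2 * \sum_i enorm (d i).
Proof.
rewrite mulr_natl mulr2n; apply: le_trans (_ : _ <= deviation x +
  (\sum_i enorm (d i) + \sum_(i < n) enorm (mean d))) _; last first.
  by rewrite !lerD2l sum_enorm_mean.
rewrite -!big_split/=; apply: ler_sum => i _; rewrite meanD.
rewrite (_ : _ - _ = (x i - mean x) + (d i - mean d)); last first.
  by rewrite opprD addrACA.
by apply: le_trans (ler_enormD _ _) _; rewrite lerD2l ler_enormB.
Qed.

Lemma sum_dist_le_deviation x :
  \sum_i \sum_j enorm (x i - x j) <= 2 * n%:R * deviation x.
Proof.
apply: (@le_trans _ _ (\sum_i \sum_j (enorm (x i - mean x) + enorm (x j - mean x)))).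
  apply: ler_sum => i _; apply: ler_sum => j _.
  by apply: le_trans (ler_dist_enormD _ (mean x) _) _; rewrite (enorm_distC (mean x)).
under eq_bigr do rewrite big_split sumr_const card_ord/=.
by rewrite big_split/= sumr_const card_ord sumrMnl -/(deviation x) -mulr_natl; lra.
Qed.

Lemma enorm_sum_nonneg (A : 'M[R]_n) x i : (forall i j, 0 <= A i j) ->
  enorm (\sum_j A i j *: x j) <= \sum_j A i j * enorm (x j).
Proof.
move=> A0; apply: le_trans (ler_enorm_sum _) _; apply: ler_sum => j _.
by rewrite enormZ ger0_norm.
Qed.

Lemma sum_enorm_stochastic (A : 'M[R]_n) x : doubly_stochastic A ->
  \sum_i enorm (\sum_j A i j *: x j) <= \sum_j enorm (x j).
Proof.
move=> [A0 _ Ac]; apply: le_trans (ler_sum _ (fun i _ => enorm_sum_nonneg _ _ A0)) _.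
by rewrite exchange_big; apply: ler_sum => j _; rewrite -mulr_suml Ac mul1r.
Qed.

Lemma mean_stochastic (A : 'M[R]_n) x : doubly_stochastic A ->
  mean (fun i => \sum_j A i j *: x j) = mean x.
Proof.
move=> [_ _ Ac]; rewrite /mean exchange_big/=; congr (_ *: _).
by apply: eq_bigr => j _; rewrite -scaler_suml Ac scale1r.
Qed.

Lemma stochastic_sub_mean (A : 'M[R]_n) x i : doubly_stochastic A ->
  \sum_j A i j *: x j - mean x = \sum_j A i j *: (x j - mean x).
Proof.
move=> [_ Ar _]; rewrite (eq_bigr _ (fun j _ => scalerBr _ _ _)) sumrB.
by rewrite -scaler_suml Ar scale1r.
Qed.

(* Subtracting the constant [eta] from the matrix is harmless on vectors of
   mean zero and leaves a nonnegative matrix with column sums [1 - n eta]. *)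
Lemma deviation_contract (A : 'M[R]_n) (eta : R) x : doubly_stochastic A ->
  (forall i j, eta <= A i j) ->
  deviation (fun i => \sum_j A i j *: x j) <= (1 - n%:R * eta) * deviation x.
Proof.
move=> Ads Aeta; have [_ _ Ac] := Ads.
rewrite /deviation mean_stochastic//.
pose C : 'M[R]_n := \matrix_(i, j) (A i j - eta).
have C0 i j : 0 <= C i j by rewrite mxE subr_ge0.
have -> : \sum_i enorm (\sum_j A i j *: x j - mean x) =
    \sum_i enorm (\sum_j C i j *: (x j - mean x)).
  apply: eq_bigr => i _; rewrite stochastic_sub_mean//; congr enorm.
  transitivity (\sum_j A i j *: (x j - mean x) - eta *: \sum_j (x j - mean x)).
    by rewrite sum_sub_mean scaler0 subr0.
  by rewrite scaler_sumr -sumrB; apply: eq_bigr => j _; rewrite mxE scalerBl.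
apply: le_trans (ler_sum _ (fun i _ => enorm_sum_nonneg _ _ C0)) _.
rewrite exchange_big mulr_sumr; apply: ler_sum => j _; rewrite -mulr_suml.
rewrite (_ : \sum_i C i j = 1 - n%:R * eta)//.
under eq_bigr do rewrite mxE; rewrite sumrB Ac sumr_const card_ord.
by rewrite mulr_natl.
Qed.

(** Later mixing does not increase the sum of the norms of an error, so the errors of the single
    steps simply add up. *)
Lemma transition_perturbed (W : nat -> 'M[R]_n) (x : 'I_n -> nat -> 'cV[R]_p)
    (e : nat -> R) t l : (0 < t)%N ->
  (forall t, (0 < t)%N -> doubly_stochastic (W t)) ->
  (forall t, (0 < t)%N ->
     \sum_i enorm (x i t.+1 - \sum_j W t i j *: x j t) <= e t) ->
  \sum_i enorm (x i (t + l)%N - \sum_j transition W t l i j *: x j t) <=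
    \sum_(s < l) e (t + s)%N.
Proof.
move=> t0 Wds xe; elim: l => [|l IHl].
  rewrite big_ord0 big1// => i _; rewrite addn0 (bigD1 i)//= big1 => [|j ji].
    by rewrite mxE eqxx scale1r addr0 subrr enorm0.
  by rewrite mxE eq_sym (negbTE ji) scale0r.
have tl0 : (0 < t + l)%N by rewrite addn_gt0 t0.
rewrite big_ord_recr/= addrC; apply: le_trans (lerD (xe _ tl0) IHl).
apply: le_trans (lerD (lexx _) (sum_enorm_stochastic _ (Wds _ tl0))).
rewrite -big_split; apply: ler_sum => i _ /=.
apply: le_trans (ler_enormD _ _); rewrite addnS le_eqVlt; apply/orP; left.
apply/eqP; congr enorm; rewrite (eq_bigr _ (fun j _ => scalerBr _ _ _)) sumrB.
rewrite subrKA; congr (_ - _).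
under eq_bigr do rewrite mxE scaler_suml.
rewrite exchange_big/=; apply: eq_bigr => j _; rewrite scaler_sumr.
by apply: eq_bigr => k _; rewrite scalerA.
Qed.

End Consensus.

(** Summing the recursion reproduces [rho] times the same sum on the right, which moves to the left.
    Only the first [L] terms escape the recursion, at a cost of [L M], and each error lies in at
    most [L] windows. *)
Lemma delayed_contraction_sum (R : realType) (D e : nat -> R) (rho M : R) (L T : nat) :
  0 <= rho < 1 -> (forall t, (0 < t)%N -> 0 <= D t <= M) -> (forall t, (0 < t)%N -> 0 <= e t) ->
  (forall t, (0 < t)%N -> D (t + L)%N <= rho * D t + 2 * \sum_(s < L) e (t + s)%N) ->
  (1 - rho) * \sum_(t < T) D t.+1 <= L%:R * M + 2 * L%:R * \sum_(t < T) e t.+1.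
Proof.
move=> /andP[rho0 rho1] DM e0 DL.
have D0 t : 0 <= D t.+1 by have /andP[] := DM t.+1 isT.
have sumD0 k : 0 <= \sum_(t < k) D t.+1 by apply: sumr_ge0.
have sume0 k : 0 <= \sum_(t < k) e t.+1 by apply: sumr_ge0 => t _; exact: e0.
have sumDM k : \sum_(t < k) D t.+1 <= k%:R * M.
  rewrite -[k in leRHS]card_ord mulr_natl -sumr_const; apply: ler_sum => t _.
  by have /andP[] := DM t.+1 isT.
have M0 : 0 <= M by have /andP[h1 h2] := DM 1%N isT; exact: le_trans h2.
have [TL|/ltnW LT] := leqP T L.
  have : (1 - rho) * \sum_(t < T) D t.+1 <= \sum_(t < T) D t.+1.
    by rewrite ler_piMl//; lra.
  move=> /le_trans; apply; apply: le_trans (sumDM T) _.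
  rewrite -[leLHS]addr0 lerD ?ler_wpM2r ?ler_nat//.
  by rewrite mulr_ge0// mulr_ge0.
have -> : T = (L + (T - L))%N by rewrite subnKC.
set k := (T - L)%N.
have split_sum F : \sum_(t < L + k) F t.+1 = \sum_(t < L) F t.+1 + \sum_(t < k) F (t.+1 + L)%N :> R.
  rewrite big_split_ord/=; congr (_ + _); apply: eq_bigr => t _.
  by rewrite addSn addnC.
have tail : \sum_(t < k) D (t.+1 + L)%N <=
    rho * \sum_(t < L + k) D t.+1 + 2 * L%:R * \sum_(t < L + k) e t.+1.
  apply: (@le_trans _ _ (rho * \sum_(t < k) D t.+1 +
      2 * \sum_(s < L) \sum_(t < k) e (t.+1 + s)%N)).
    rewrite exchange_big/= 2!mulr_sumr -big_split; apply: ler_sum => t _.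
    exact: DL.
  rewrite lerD//.
    rewrite ler_wpM2l// addnC big_split_ord/= lerDl; apply: sumr_ge0 => t _.
    exact: D0.
  have window (s : 'I_L) : \sum_(t < k) e (t.+1 + s)%N <= \sum_(t < L + k) e t.+1.
    have <- : (s + k + (L - s))%N = (L + k)%N by rewrite addnAC subnKC// ltnW.
    rewrite big_split_ord big_split_ord/= -addrA [leRHS]addrCA.
    rewrite -[leLHS]addr0 lerD//; last first.
      by rewrite addr_ge0// sumr_ge0// => t _; exact: e0.
    by apply: ler_sum => t _; rewrite addSn addnC.
  rewrite -mulrA ler_wpM2l//; apply: le_trans (ler_sum _ (fun s _ => window s)) _.
  by rewrite sumr_const card_ord mulr_natl.
move: tail (sumDM L); rewrite mulrBl mul1r split_sum; lra.
Qed.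

(** [C] is fixed before the trajectory and its disturbances: it depends on the matrices alone, which
    makes the final constant uniform over runs. *)
Lemma sum_deviation_le (R : realType) (n p : nat) (E : nat -> rel 'I_n)
    (W : nat -> 'M[R]_n) :
  (0 < n)%N -> mixing E W -> assumption2 E W ->
  exists C : R, 0 <= C /\
    forall (x : 'I_n -> nat -> 'cV[R]_p) (e : nat -> R) (M : R),
    (forall t, (0 < t)%N ->
       \sum_i enorm (x i t.+1 - \sum_j W t i j *: x j t) <= e t) ->
    (forall t, (0 < t)%N -> deviation (x^~ t) <= M) ->
    forall T, \sum_(t < T) deviation (x^~ t.+1) <= C * (M + \sum_(t < T) e t.+1).
Proof.
move=> n_gt0 EW [[w [/andP[w0 _] Ww]] Wds [B [_ conn]]].
have [L [eta [eta0 Weta]]] := transition_pos EW Wds w0 Ww conn n_gt0.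
have n0 : 0 < n%:R :> R by rewrite ltr0n.
have neta0 : 0 < n%:R * eta by rewrite mulr_gt0.
have neta1 : n%:R * eta <= 1.
  have [_ Ar _] := transition_doubly_stochastic L (ltn0Sn 0) Wds.
  rewrite -[leRHS](Ar (Ordinal n_gt0)) (_ : n%:R * eta = \sum_(j < n) eta).
    by apply: ler_sum => j _; exact: Weta.
  by rewrite sumr_const card_ord mulr_natl.
(* Here [1 - rho] is [n eta], and [L M] is enlarged to [2 L M] so that one factor serves both
   terms. *)
exists (2 * L%:R / (n%:R * eta)); split.
  by rewrite divr_ge0 ?(ltW neta0)// ?mulr_ge0.
move=> x e M xe xM T.
have e0 t : (0 < t)%N -> 0 <= e t.
  move=> /xe; apply: le_trans; apply: sumr_ge0 => i _; exact: enorm_ge0.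
have M0 : 0 <= M by apply: le_trans (xM 1%N isT); exact: deviation_ge0.
have step t : (0 < t)%N -> deviation (x^~ (t + L)%N) <=
    (1 - n%:R * eta) * deviation (x^~ t) + 2 * \sum_(s < L) e (t + s)%N.
  move=> t0; have dsA := transition_doubly_stochastic L t0 Wds.
  have := deviation_contract n_gt0 (x^~ t) dsA (fun i j => Weta t i j t0).
  have := transition_perturbed L t0 Wds xe.
  pose Ax i := \sum_j transition W t L i j *: x j t.
  have := deviationD n_gt0 Ax (fun i => x i (t + L)%N - Ax i).
  have -> : (fun i => Ax i + (x i (t + L)%N - Ax i)) = x^~ (t + L)%N.
    by apply/funext => i; exact: subrKC.
  rewrite -/Ax; lra.
have rho01 : 0 <= 1 - n%:R * eta < 1 by rewrite subr_ge0 neta1 ltrBlDr ltrDl.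
have DM t : (0 < t)%N -> 0 <= deviation (x^~ t) <= M.
  by move=> t0; rewrite deviation_ge0 xM.
have := delayed_contraction_sum T rho01 DM e0 step; rewrite subKr.
set S := \sum_(t < T) deviation _; set a := n%:R * eta in neta0 *.
set Se := \sum_(t < T) _ => h; rewrite -(ler_pM2l neta0).
have -> : a * (2 * L%:R / a * (M + Se)) = 2 * L%:R * (M + Se).
  by field; rewrite gt_eqF.
apply: le_trans h _; have : 0 <= L%:R * M by rewrite mulr_ge0.
by rewrite mulrDr; lra.
Qed.

(** * One step of the algorithm *)

Section PosPart.
Context (R : realType) (m : nat).
Implicit Types (u v mu q b : 'cV[R]_m) (N : R).

Lemma pospartE v k : pospart v k 0 = Num.max 0 (v k 0).
Proof. by rewrite mxE. Qed.

Lemma pospart_ge0 v k : 0 <= pospart v k 0.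
Proof. by rewrite pospartE le_max lexx. Qed.

Lemma enorm_pospart v : enorm (pospart v) <= enorm v.
Proof.
apply: enorm_mono => k; rewrite ger0_norm ?pospart_ge0// pospartE.
by rewrite ge_max normr_ge0 ler_norm.
Qed.

Lemma pospart_nonpos v : nonpos v -> pospart v = 0.
Proof. by move=> v0; apply/colP => k; rewrite pospartE mxE; apply/max_idPl. Qed.

Lemma enorm_pospart_sub v mu : (forall k, 0 <= mu k 0) ->
  enorm (pospart v - mu) <= enorm (v - mu).
Proof.
move=> mu0; apply: enorm_mono => k; rewrite !mxE; have := mu0 k.
by case: (leP 0 (v k 0)) => // v0 mu0k; rewrite !ler0_norm; lra.
Qed.

Lemma enorm_le_sum u : (forall k, 0 <= u k 0) -> enorm u <= \sum_k u k 0.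
Proof.
move=> u0; have sum0 : 0 <= \sum_k u k 0 by apply: sumr_ge0 => k _; exact: u0.
rewrite -(@ler_pXn2r _ 2) ?nnegrE ?enorm_ge0// sqr_enorm expr2 mulr_suml.
apply: ler_sum => k _; rewrite expr2 ler_wpM2l// (bigD1 k)//= lerDl.
by apply: sumr_ge0 => j _; exact: u0.
Qed.

Lemma inner_const_mx N u : inner (const_mx N) u = N * \sum_k u k 0.
Proof. by rewrite mulr_sumr; apply: eq_bigr => k _; rewrite mxE. Qed.

Lemma enorm_const_mx N : 0 <= N ->
  enorm (const_mx N : 'cV[R]_m) = N * enorm (const_mx 1 : 'cV[R]_m).
Proof.
move=> N0; rewrite -[N in RHS]ger0_norm// -enormZ; congr enorm.
by apply/colP => k; rewrite !mxE mulr1.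
Qed.

Lemma inner_ge0 u v : (forall k, 0 <= u k 0) -> (forall k, 0 <= v k 0) -> 0 <= inner u v.
Proof. by move=> u0 v0; apply: sumr_ge0 => k _; rewrite mulr_ge0. Qed.

(** Taking positive parts brings a vector no farther from [mu >= 0], and the argument is
    [q + gamma (b - beta q)] with a bracket of norm at most [2 G]. The identity [2 <q, q - mu> =
    |q|^2 + |q - mu|^2 - |mu|^2] gives the contraction factor; the square of [q] has a favourable
    sign and is dropped. *)
Lemma dual_step q b mu (beta gamma G : R) :
  0 <= beta -> 0 <= gamma -> (forall k, 0 <= mu k 0) ->
  enorm b <= G -> beta * enorm q <= G ->
  enorm (pospart ((1 - beta * gamma) *: q + gamma *: b) - mu) ^+ 2
    - (1 - beta * gamma) * enorm (q - mu) ^+ 2 <=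
  2 * gamma * (inner q b - inner mu b) + gamma * beta * enorm mu ^+ 2
    + gamma ^+ 2 * (4 * G ^+ 2).
Proof.
move=> beta0 gamma0 mu0 bG qG.
set v := (1 - beta * gamma) *: q + gamma *: b.
have : enorm (pospart v - mu) ^+ 2 <= enorm (v - mu) ^+ 2.
  by rewrite ler_pXn2r ?nnegrE ?enorm_ge0// enorm_pospart_sub.
have -> : v - mu = (q - mu) + gamma *: (b - beta *: q).
  rewrite /v scalerBr scalerA scalerBl scale1r (mulrC gamma).
  by apply/colP => k; rewrite !mxE; ring.
have bq : enorm (b - beta *: q) <= 2 * G.
  apply: le_trans (ler_enormB _ _) _.
  by rewrite enormZ ger0_norm//; lra.
have bq2 : enorm (b - beta *: q) ^+ 2 <= 4 * G ^+ 2.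
  rewrite (_ : 4 * G ^+ 2 = (2 * G) ^+ 2); last by ring.
  by rewrite ler_pXn2r ?nnegrE ?enorm_ge0// (le_trans (enorm_ge0 _) bq).
have {bq2} := ler_wpM2l (sqr_ge0 gamma) bq2.
rewrite (sqr_enormD (q - mu)) enormZ exprMn real_normK ?num_real//.
have := mulr_ge0 (mulr_ge0 beta0 gamma0) (sqr_ge0 (enorm q)).
rewrite (sqr_enormD q) enormN -(inner_self q) !innerE (innerC mu q).
lra.
Qed.

End PosPart.

Section ConstraintSubgradient.
Context (R : realType) (p m : nat) (X : set 'cV[R]_p).
Context (g : 'cV[R]_p -> 'cV[R]_m) (x : 'cV[R]_p) (A A' : 'M[R]_(p, m)).
Context (F2 : R) (F2_ge0 : 0 <= F2) (A_le : specnorm A <= F2).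
Context (A_sub : forall k, is_subgradient X (fun y => g y k 0) x (col k A)).
Context (A'_sub : forall k, exists s : R,
    [/\ col k A' = s *: col k A, 0 < g x k 0 -> s = 1,
        g x k 0 < 0 -> s = 0 & g x k 0 = 0 -> 0 <= s <= 1]).

(** [A'] is [A] times a diagonal matrix with entries in [[0, 1]], and shrinking coordinates does not
    increase the norm. *)
Lemma mulmx_pospart_subgradient v : enorm (A' *m v) <= F2 * enorm v.
Proof.
have [s sP] := choice A'_sub.
have s01 k : 0 <= s k <= 1.
  have [_ s1 s0 s01] := sP k; have [gx|gx|/esym gx] := ltgtP 0 (g x k 0).
  - by rewrite s1// lexx ler01.
  - by rewrite s0// lexx ler01.
  - exact: s01.
have -> : A' *m v = A *m (\col_k (s k * v k 0)).
  apply/colP => i; rewrite !mxE; apply: eq_bigr => k _.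
  have [/colP/(_ i)] := sP k; rewrite !mxE => -> _ _ _; ring.
apply: le_trans (specnorm_le A_le _) _; rewrite ler_wpM2l//.
apply: enorm_mono => k; rewrite mxE normrM ler_piMl//.
by have /andP[s0 s1] := s01 k; rewrite ger0_norm.
Qed.

Lemma trmx_mulmx_le (B : 'M[R]_(p, m)) (c : R) : 0 <= c ->
  (forall v, enorm (B *m v) <= c * enorm v) ->
  forall u, enorm (B^T *m u) <= c * enorm u.
Proof.
move=> c0 Bc u; set v := B^T *m u; have [v0|v_neq0] := eqVneq (enorm v) 0.
  by rewrite v0 mulr_ge0 ?enorm_ge0.
have v_gt0 : 0 < enorm v by rewrite lt_neqAle eq_sym v_neq0 enorm_ge0.
rewrite -(ler_pM2r v_gt0) -expr2 -inner_self {2}/v -inner_mulmx.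
apply: le_trans (inner_le _ _) _; rewrite mulrAC ler_wpM2r ?enorm_ge0//.
Qed.

Lemma pospart_subgradient y k : X y ->
  pospart (g x) k 0 + (A'^T *m (y - x)) k 0 <= pospart (g y) k 0.
Proof.
move=> Xy; have [s [sE s1 s0 s01]] := A'_sub k.
have -> : (A'^T *m (y - x)) k 0 = s * inner (col k A) (y - x).
  rewrite -innerZl -sE mxE; apply: eq_bigr => i _; by rewrite !mxE.
have := A_sub k Xy; rewrite !pospartE; set I := inner _ _ => h.
have max0 : 0 <= Num.max 0 (g y k 0) by rewrite le_max lexx.
have maxg : g y k 0 <= Num.max 0 (g y k 0) by rewrite le_max lexx orbT.
have [gx|gx|/esym gx] := ltgtP 0 (g x k 0).
- rewrite s1// mul1r; lra.
- by rewrite s0// mul0r addr0.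
- by have := s01 gx; move: h; rewrite gx !add0r; nra.
Qed.

(** This transfers a violation measured at one agent's iterate to another agent's iterate. *)
Lemma enorm_pospart_lipschitz y : X y ->
  enorm (pospart (g x)) <= enorm (pospart (g y)) + F2 * enorm (x - y).
Proof.
move=> Xy; have A'T := trmx_mulmx_le F2_ge0 mulmx_pospart_subgradient.
apply: le_trans (lerD (lexx _) (A'T _)); apply: le_trans (ler_enormD _ _).
apply: enorm_mono => k; rewrite ger0_norm ?pospart_ge0//.
apply: le_trans (ler_norm _); have := pospart_subgradient k Xy.
by rewrite -(opprB x y) mulmxN !mxE; lra.
Qed.

End ConstraintSubgradient.

(** * Primal and dual inequality of one agent *)

Section AgentStep.
Context (R : realType) (p m : nat) (X : set 'cV[R]_p).
Context (X_neq0 : X !=set0) (X_convex : convex_set X) (X_closed : closed X).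
Context (RX : R) (X_bounded : forall x, X x -> enorm x <= RX).
Context (f : 'cV[R]_p -> R) (g : 'cV[R]_p -> 'cV[R]_m) (x s : 'cV[R]_p).
Context (A A' : 'M[R]_(p, m)) (F1 F2 : R) (F2_ge0 : 0 <= F2).
Context (Xx : X x) (f_sub : is_subgradient X f x s) (s_le : enorm s <= F2).
Context (g_le : enorm (g x) <= F1) (A_le : specnorm A <= F2).
Context (A_sub : forall k, is_subgradient X (fun y => g y k 0) x (col k A)).
Context (A'_sub : forall k, exists s : R,
    [/\ col k A' = s *: col k A, 0 < g x k 0 -> s = 1,
        g x k 0 < 0 -> s = 0 & g x k 0 = 0 -> 0 <= s <= 1]).
Context (z : 'cV[R]_p) (q : 'cV[R]_m) (q_ge0 : forall k, 0 <= q k 0).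
Context (alpha beta gamma : R) (alpha_gt0 : 0 < alpha) (beta_ge0 : 0 <= beta)
  (gamma_gt0 : 0 < gamma).

Let x' := eproj X (z - alpha *: (s + A' *m q)).
Let b := pospart (g x) + A'^T *m (x' - x).
Let q' := pospart ((1 - beta * gamma) *: q + gamma *: b).

Let Xx' : X x'. Proof. exact: eproj_in X_bounded _. Qed.

Lemma linearized_constraint_le : enorm b <= F1 + 2 * RX * F2.
Proof.
have A'T := trmx_mulmx_le F2_ge0 (mulmx_pospart_subgradient F2_ge0 A_le A'_sub).
apply: le_trans (ler_enormD _ _) _; apply: lerD.
  exact: le_trans (enorm_pospart _) g_le.
apply: le_trans (A'T _) _; rewrite mulrC ler_wpM2r//.
by apply: le_trans (ler_enormB _ _) _; have := X_bounded Xx; have := X_bounded Xx'; lra.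
Qed.

Lemma dual_growth : beta * gamma <= 1 ->
  enorm q' <= (1 - beta * gamma) * enorm q + gamma * (F1 + 2 * RX * F2).
Proof.
move=> bg1; apply: le_trans (enorm_pospart _) _; apply: le_trans (ler_enormD _ _) _.
rewrite !enormZ (ger0_norm (ltW gamma_gt0)) ger0_norm ?subr_ge0//.
by rewrite lerD2l ler_wpM2l ?(ltW gamma_gt0)// linearized_constraint_le.
Qed.

(** Both [inner q b] and the pairing of [A' *m q] with [x' - y] contain the product of [q] with
    [A'^T *m (x' - x)], which cancels. The rest is [q] against the linearization at the feasible
    [y], which is nonpositive, so the size of [q] never enters. *)
Lemma primal_step y : X y -> nonpos (g y) ->
  f x - f y + inner q b <= F2 * enorm (x' - x)
    + (enorm (z - y) ^+ 2 - enorm (x' - y) ^+ 2 - enorm (x' - z) ^+ 2) / (2 * alpha).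
Proof.
move=> Xy gy.
have := eproj_step X_neq0 X_convex X_closed X_bounded z (s + A' *m q) alpha Xy.
rewrite -/x'; set w := s + _ => step.
have wE : f x - f y + inner q b - F2 * enorm (x' - x) <= inner w (x' - y).
  rewrite /w innerDl inner_mulmx (_ : x' - y = (x' - x) - (y - x)); last first.
    by rewrite opprB subrKA.
  rewrite mulmxBr 2!innerDr !innerNr.
  have := f_sub Xy; have : - inner s (x' - x) <= F2 * enorm (x' - x).
    rewrite -innerNl; apply: le_trans (inner_le _ _) _.
    by rewrite enormN ler_wpM2r ?enorm_ge0.
  have : 0 <= inner q (- (pospart (g x) + A'^T *m (y - x))).
    apply: inner_ge0 => // k; rewrite mxE oppr_ge0 mxE.
    apply: le_trans (pospart_subgradient A_sub A'_sub k Xy) _.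
    by rewrite pospart_nonpos// mxE.
  rewrite /b !innerE; lra.
rewrite -lerBlDl; rewrite ler_pdivlMr ?mulr_gt0//.
have := ler_wpM2l (ltW alpha_gt0) wE; lra.
Qed.

(** Adding [dual_step] at the constant vector [N] eliminates [inner q b]. Pairing that vector with
    [b] yields at least [N] times the norm of the violation, up to a multiple of the movement. *)
Lemma agent_step y N : X y -> nonpos (g y) -> 0 <= N ->
  beta * enorm q <= F1 + 2 * RX * F2 ->
  f x - f y + N * enorm (pospart (g x))
    + (enorm (q' - const_mx N) ^+ 2
       - (1 - beta * gamma) * enorm (q - const_mx N) ^+ 2) / (2 * gamma)
  <= F2 * (1 + N * enorm (const_mx 1 : 'cV[R]_m)) * enorm (x' - x)
    + (enorm (z - y) ^+ 2 - enorm (x' - y) ^+ 2 - enorm (x' - z) ^+ 2) / (2 * alpha)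
    + beta * (N * enorm (const_mx 1 : 'cV[R]_m)) ^+ 2 / 2
    + gamma * (2 * (F1 + 2 * RX * F2) ^+ 2).
Proof.
move=> Xy gy N0 qG; set G := F1 + _.
have N_ge0 k : 0 <= (const_mx N : 'cV[R]_m) k 0 by rewrite mxE.
have := dual_step beta_ge0 (ltW gamma_gt0) N_ge0 linearized_constraint_le qG.
rewrite -/q' enorm_const_mx//; set c := enorm (const_mx 1); set Q := _ - _ => dual.
have {}dual : Q / (2 * gamma) <= inner q b - inner (const_mx N) b
    + beta * (N * c) ^+ 2 / 2 + gamma * (2 * G ^+ 2).
  by rewrite ler_pdivrMr ?mulr_gt0//; apply: le_trans dual _; rewrite -/G; lra.
have mu_b : N * enorm (pospart (g x)) - F2 * (N * c) * enorm (x' - x) <= inner (const_mx N) b.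
  rewrite /b innerDr inner_const_mx; apply: lerD.
    by rewrite ler_wpM2l// enorm_le_sum// => k; exact: pospart_ge0.
  rewrite lerNl -innerNr; apply: le_trans (inner_le _ _) _.
  rewrite enormN enorm_const_mx// -/c (mulrC F2) -[leRHS]mulrA ler_wpM2l ?mulr_ge0 ?enorm_ge0//.
  exact: (trmx_mulmx_le F2_ge0 (mulmx_pospart_subgradient F2_ge0 A_le A'_sub)).
have := primal_step Xy gy; lra.
Qed.

End AgentStep.

Section StackedConstraint.
Context (R : realType) (n : nat) (m : 'I_n -> nat) (v : forall i, 'cV[R]_(m i)).

Lemma nonpos_mxcol i : nonpos (\mxcol_i v i) -> nonpos (v i).
Proof. by move=> h k; rewrite -(mxcolK v i) mxE; exact: h. Qed.

Lemma enorm_pospart_mxcol :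
  enorm (pospart (\mxcol_i v i)) <= \sum_i enorm (pospart (v i)).
Proof.
have -> : pospart (\mxcol_i v i) = \mxcol_i pospart (v i).
  by apply/colP => k; rewrite !mxE.
have S0 : 0 <= \sum_i enorm (pospart (v i)) by apply: sumr_ge0 => i _; exact: enorm_ge0.
rewrite -(@ler_pXn2r _ 2) ?nnegrE ?enorm_ge0//.
have innerE (r : nat) (a : 'cV[R]_r) : enorm a ^+ 2 = (a^T *m a) 0 0.
  by rewrite -inner_self mxE; apply: eq_bigr => k _; rewrite mxE.
rewrite innerE tr_mxcol mul_mxrow_mxcol summxE expr2 mulr_suml.
apply: ler_sum => i _; rewrite -innerE expr2 ler_wpM2l ?enorm_ge0//.
by rewrite (bigD1 i)//= lerDl sumr_ge0// => j _; exact: enorm_ge0.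
Qed.

End StackedConstraint.

(** * Sums and rates *)

Section Sums.
Context (R : realType).

Lemma sum_const_natmul (n : nat) (a : R) : \sum_(i < n) a = n%:R * a.
Proof. by rewrite sumr_const card_ord mulr_natl. Qed.

Lemma sum_le_natmul (n : nat) (F : 'I_n -> R) (a : R) :
  (forall i, F i <= a) -> \sum_i F i <= n%:R * a.
Proof. by move=> Fa; rewrite -sum_const_natmul ler_sum. Qed.

Lemma sum_weighted_telescope (r V : nat -> R) (M : R) (T : nat) : (0 < T)%N ->
  (forall t, (0 < t)%N -> 0 <= r t <= r t.+1) ->
  (forall t, (0 < t)%N -> 0 <= V t <= M) ->
  \sum_(t < T) r t.+1 * (V t.+1 - V t.+2) <= r T * M.
Proof.
move=> T0 rr VM; case: T T0 => // T _.
(* The induction needs the last term [V] kept: when the weight grows, it multiplies [M - V], which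
   is nonnegative. *)
apply: (@le_trans _ _ (r T.+1 * (M - V T.+2))); last first.
  have /andP[r0 _] := rr T.+1 isT; have /andP[V0 _] := VM T.+2 isT.
  by rewrite ler_wpM2l// lerBlDr lerDl.
elim: T => [|T IHT].
  rewrite big_ord1 ler_wpM2l//; first by have /andP[] := rr 1%N isT.
  by rewrite lerD2r; have /andP[] := VM 1%N isT.
rewrite big_ord_recr/=; apply: le_trans (lerD IHT (lexx _)) _.
have /andP[_ rT] := rr T.+1 isT; have /andP[_ VT] := VM T.+2 isT.
by rewrite -subr_ge0 in VT; have := ler_wpM2r VT rT; lra.
Qed.

Lemma sum_weighted_le (r u : nat -> R) (T : nat) :
  (forall t, (0 < t)%N -> 0 <= r t <= r t.+1) -> (forall t, (0 < t)%N -> 0 <= u t) ->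
  \sum_(t < T) r t.+1 * u t.+1 <= r T * \sum_(t < T) u t.+1.
Proof.
move=> rr u0; elim: T => [|T IHT]; first by rewrite !big_ord0 mulr0.
rewrite !big_ord_recr/= mulrDr lerD//; apply: le_trans IHT _.
have sum0 : 0 <= \sum_(t < T) u t.+1 by apply: sumr_ge0 => t _; exact: u0.
case: T sum0 => [|T] sum0; first by rewrite big_ord0 !mulr0.
by rewrite ler_wpM2r//; have /andP[] := rr T.+1 isT.
Qed.

Lemma sum_dual_telescope (Q a h : nat -> R) (T : nat) :
  (forall t, (0 < t)%N -> 0 <= Q t) -> (forall t, (0 < t)%N -> 0 <= h t) ->
  (forall t, (0 < t)%N -> a t.+1 * h t.+1 <= h t) ->
  - (Q 1%N * h 1%N) <= \sum_(t < T) (Q t.+2 - a t.+2 * Q t.+1) * h t.+2.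
Proof.
move=> Q0 h0 ah; apply: (@le_trans _ _ (Q T.+1 * h T.+1 - Q 1%N * h 1%N)).
  by rewrite lerDr mulr_ge0// ?Q0 ?h0.
elim: T => [|T IHT]; first by rewrite subrr big_ord0.
rewrite big_ord_recr/=; apply: le_trans (lerD IHT (lexx _)).
have := ler_wpM2l (Q0 T.+1 isT) (ah T.+1 isT); lra.
Qed.

Lemma powR_le_tangent (u b : R) : 0 < u -> 0 <= b <= 1 -> u `^ b <= 1 - b + b * u.
Proof.
move=> u0 b01; rewrite /powR gt_eqF//.
have {2}-> : u = expR (ln u) by rewrite lnK// posrE.
set l := ln u; have e0 := expR_gt0 (b * l).
(* Tangent lines at [b l] lie below the graph of the exponential. *)
have h1 : expR (b * l) * (1 + (1 - b) * l) <= expR l.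
  have -> : expR l = expR (b * l) * expR ((1 - b) * l) by rewrite -expRD; congr expR; ring.
  by rewrite ler_pM2l// expR_ge1Dx.
have h2 : expR (b * l) * (1 - b * l) <= 1.
  have := expR_ge1Dx (- (b * l)); rewrite -(ler_pM2l e0) expRN mulfV//.
  by rewrite gt_eqF.
(* Weighting [h1] by [b] and [h2] by [1 - b] makes the terms in [l] cancel. *)
by case/andP: b01 => b0 b1; nra.
Qed.

(** By concavity of the power, its increment is at least its derivative at the right end; summed
    over [k], the right-hand side telescopes. The case [k = 0] is separate because the tangent bound
    needs a positive ratio. *)
Lemma powR_pred_le (b : R) (k : nat) : 0 < b <= 1 ->
  b * k.+1%:R `^ (b - 1) <= k.+1%:R `^ b - k%:R `^ b.
Proof.
move=> /andP[b0 b1]; case: k => [|k].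
  by rewrite !powR1 powR0 ?gt_eqF// subr0 mulr1.
have u0 : 0 < k.+1%:R / k.+2%:R :> R by rewrite divr_gt0.
have b01 : 0 <= b <= 1 by rewrite ltW.
have := powR_le_tangent u0 b01.
have -> : k.+1%:R `^ b = k.+2%:R `^ b * (k.+1%:R / k.+2%:R) `^ b :> R.
  by rewrite -powRM ?ltW// mulrC divfK// pnatr_eq0.
rewrite powRB ?pnatr_eq0 ?implybT// powRr1//.
have p0 : 0 <= k.+2%:R `^ b :> R by exact: powR_ge0.
move=> /(ler_wpM2l p0) h.
have -> : b * (k.+2%:R `^ b / k.+2%:R) =
    k.+2%:R `^ b - k.+2%:R `^ b * (1 - b + b * (k.+1%:R / k.+2%:R)) :> R.
  have : k.+1%:R + 1 != 0 :> R by rewrite natr1 pnatr_eq0.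
  by rewrite -(natr1 k.+1); move: k.+1%:R => a a0; field.
by rewrite lerD2l lerN2.
Qed.

Lemma sum_powR_le (b : R) (T : nat) : 0 < b <= 1 ->
  \sum_(t < T) t.+1%:R `^ (b - 1) <= T%:R `^ b / b.
Proof.
move=> b01; have /andP[b0 _] := b01; rewrite ler_pdivlMr// mulrC mulr_sumr.
elim: T => [|T IHT]; first by rewrite big_ord0 powR_ge0.
rewrite big_ord_recr/=; have := powR_pred_le T b01; lra.
Qed.

End Sums.

Local Ltac nonneg :=
  repeat first [done | exact: sqr_ge0 | apply: addr_ge0 | apply: mulr_ge0
               | rewrite invr_ge0].

(** All dependence on the horizon is isolated here: [u], [v], [s] stand for the powers of [T] with
    exponents [1 - kappa], [kappa] and [1/2]. [C] is chosen before [N], [K] and [P], so [N] may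
    later grow with [T] and the comparator stays arbitrary. *)
Lemma bound_collect (R : realType) (n c G RX F2 Cc b k a ra ta : R) :
  0 <= n -> 0 <= c -> 0 <= RX -> 0 <= F2 -> 0 <= Cc ->
  0 <= b -> 0 <= k -> 0 <= a -> 0 <= ra -> 0 <= ta ->
  exists C : R, 0 < C /\
    forall (N K P u v s Sb Sg Sa r St : R),
    let J := F2 * (1 + N * c) * (1 + 2 * Cc) + K * Cc in
    0 <= N -> 0 <= K -> 0 <= P -> 1 <= u -> 0 <= v -> 1 <= s ->
    Sb <= b * u -> Sg <= k * v -> Sa <= a * s -> 0 <= r <= ra * s -> 0 <= St <= ta ->
    n * (N * c) ^+ 2 / 2 * (1 + Sb) + 2 * n * G ^+ 2 * Sg
      + r * (n * (2 * RX) ^+ 2 + n * (4 * RX * P + (4 * RX + 1) * St))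
      + J * (n * (2 * RX) + n * St) + n * J ^+ 2 / 2 * Sa
    <= C * (N ^+ 2 * u + v + s * P + (1 + N + K) ^+ 2 * s).
Proof.
move=> n0 c0 RX0 F20 Cc0 b0 k0 a0 ra0 ta0.
pose CJ := F2 * (1 + c) * (1 + 2 * Cc) + Cc.
have CJ0 : 0 <= CJ by nonneg.
pose D1 := n * c ^+ 2 / 2 * (1 + b).
pose D2 := 2 * n * G ^+ 2 * k.
pose D3 := ra * (n * (4 * RX)).
pose D4 := ra * (n * (2 * RX) ^+ 2 + n * ((4 * RX + 1) * ta)).
pose D5 := CJ * (n * (2 * RX) + n * ta).
pose D6 := n * CJ ^+ 2 / 2 * a.
have D10 : 0 <= D1 by nonneg.
have D20 : 0 <= D2 by nonneg.
have D30 : 0 <= D3 by nonneg.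
have D40 : 0 <= D4 by nonneg.
have D50 : 0 <= D5 by nonneg.
have D60 : 0 <= D6 by nonneg.
pose C := 1 + D1 + D2 + D3 + (D4 + D5 + D6).
exists C; split; first by rewrite /C; lra.
move=> N K P u v s Sb Sg Sa r St J N0 K0 P0 u1 v0 s1 hSb hSg hSa.
move=> /andP[r0 hr] /andP[St0 hSt].
have s0 : 0 <= s by lra.
have u0 : 0 <= u by lra.
have M1 : 1 <= 1 + N + K by lra.
(* [J] is affine in [N] and [K], hence at most a constant times [M]; since [M >= 1], terms of degree
   0 and 1 are absorbed by [M ^+ 2]. *)
set M := 1 + N + K in M1 *.
have M0 : 0 <= M by lra.
have M21 : 1 <= M ^+ 2 by rewrite exprn_ege1.
have MM2 : M <= M ^+ 2 by rewrite expr2 ler_peMl.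
have J0 : 0 <= J by nonneg.
have JM : J <= CJ * M.
  have h1 : 1 + N * c <= (1 + c) * M by rewrite /M; have := mulr_ge0 c0 K0; lra.
  have h2 : K <= M by rewrite /M; lra.
  have := ler_wpM2l F20 h1 => h3; have Cc1 : 0 <= 1 + 2 * Cc by lra.
  have := ler_wpM2r Cc1 h3; have := ler_wpM2r Cc0 h2; rewrite /J /CJ; lra.
have T1 : n * (N * c) ^+ 2 / 2 * (1 + Sb) <= D1 * (N ^+ 2 * u).
  have h : 1 + Sb <= (1 + b) * u by lra.
  have k1 : 0 <= n * (N * c) ^+ 2 / 2 by nonneg.
  by have := ler_wpM2l k1 h; rewrite /D1; lra.
have T2 : 2 * n * G ^+ 2 * Sg <= D2 * v.
  have k1 : 0 <= 2 * n * G ^+ 2 by nonneg.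
  by have := ler_wpM2l k1 hSg; rewrite /D2; lra.
have sM : s <= M ^+ 2 * s by rewrite ler_peMl.
have T3 : r * (n * (2 * RX) ^+ 2 + n * (4 * RX * P + (4 * RX + 1) * St)) <=
    D3 * (s * P) + D4 * (M ^+ 2 * s).
  apply: (@le_trans _ _ (ra * s * (n * (2 * RX) ^+ 2 + n * (4 * RX * P + (4 * RX + 1) * ta)))).
    have e0 : 0 <= n * (2 * RX) ^+ 2 + n * (4 * RX * P + (4 * RX + 1) * St).
      by nonneg.
    apply: ler_pM => //; rewrite lerD2l ler_wpM2l// lerD2l ler_wpM2l//; lra.
  by have := ler_wpM2l D40 sM; rewrite /D3 /D4; lra.
have T4 : J * (n * (2 * RX) + n * St) <= D5 * (M ^+ 2 * s).
  apply: (@le_trans _ _ (CJ * M * (n * (2 * RX) + n * ta))).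
    apply: ler_pM => //; first by nonneg.
    by rewrite lerD2l ler_wpM2l.
  have Ms : M <= M ^+ 2 * s by apply: le_trans MM2 _; rewrite ler_peMr ?sqr_ge0.
  by have := ler_wpM2l D50 Ms; rewrite /D5; lra.
have T5 : n * J ^+ 2 / 2 * Sa <= D6 * (M ^+ 2 * s).
  have J2 : J ^+ 2 <= (CJ * M) ^+ 2 by rewrite ler_pXn2r ?nnegrE//; nonneg.
  have k1 : 0 <= n * J ^+ 2 / 2 by nonneg.
  have := ler_wpM2l k1 hSa => h; apply: (le_trans h).
  have k2 : 0 <= n * (a * s) / 2 by nonneg.
  by have := ler_wpM2l k2 J2; rewrite /D6; lra.
have Nu0 : 0 <= N ^+ 2 * u by nonneg.
have sP0 : 0 <= s * P by nonneg.
have Ms0 : 0 <= M ^+ 2 * s by nonneg.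
have C1 : D1 <= C by rewrite /C; lra.
have C2 : D2 <= C by rewrite /C; lra.
have C3 : D3 <= C by rewrite /C; lra.
have C4 : D4 + D5 + D6 <= C by rewrite /C; lra.
have := ler_wpM2r Nu0 C1; have := ler_wpM2r v0 C2; have := ler_wpM2r sP0 C3.
have := ler_wpM2r Ms0 C4; move: T1 T2 T3 T4 T5.
clearbody C D1 D2 D3 D4 D5 D6.
lra.
Qed.

(** * A run of the algorithm *)

(** Jensen's inequality for the square, obtained from the nonnegativity of the weighted variance of
    each row. *)
Lemma sum_sqr_enorm_stochastic (R : realType) (n p : nat) (A : 'M[R]_n)
    (v : 'I_n -> 'cV[R]_p) : doubly_stochastic A ->
  \sum_i enorm (\sum_j A i j *: v j) ^+ 2 <= \sum_j enorm (v j) ^+ 2.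
Proof.
move=> [A0 Ar Ac].
apply: (@le_trans _ _ (\sum_i \sum_j A i j * enorm (v j) ^+ 2)); last first.
  by rewrite exchange_big; apply: ler_sum => j _; rewrite -mulr_suml Ac mul1r.
apply: ler_sum => i _; set w := \sum_j _ *: _.
have : 0 <= \sum_j A i j * enorm (v j - w) ^+ 2.
  by apply: sumr_ge0 => j _; rewrite mulr_ge0// sqr_ge0.
have -> : \sum_j A i j * enorm (v j - w) ^+ 2 =
    \sum_j A i j * enorm (v j) ^+ 2 - 2 * inner w w + enorm w ^+ 2.
  have -> : enorm w ^+ 2 = \sum_j A i j * enorm w ^+ 2 by rewrite -mulr_suml Ar mul1r.
  rewrite {2}/w inner_suml mulr_sumr -sumrB -big_split; apply: eq_bigr => j _.
  by rewrite sqr_enormD enormN innerNr innerZl/=; ring.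
rewrite inner_self; lra.
Qed.

Section Run.
Context (R : realType) (n p : nat) (n_gt0 : (0 < n)%N) (m : 'I_n -> nat).
Context (X : set 'cV[R]_p).
Context (f : 'I_n -> nat -> 'cV[R]_p -> R)
  (g : forall i : 'I_n, nat -> 'cV[R]_p -> 'cV[R]_(m i))
  (df : 'I_n -> nat -> 'cV[R]_p -> 'cV[R]_p)
  (dg dgpos : forall i : 'I_n, nat -> 'cV[R]_p -> 'M[R]_(p, m i)).
Context (W : nat -> 'M[R]_n) (Wds : forall t, (0 < t)%N -> doubly_stochastic (W t)).
Context (X_convex : convex_set X) (X_closed : closed X).
Context (RX : R) (X_bounded : forall x, X x -> enorm x <= RX).
Context (f_sub : forall i t x, (0 < t)%N -> X x -> is_subgradient X (f i t) x (df i t x)).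
Context (g_sub : forall i t x k, (0 < t)%N -> X x ->
  is_subgradient X (fun y => g i t y k 0) x (col k (dg i t x))).
Context (gpos_sub : pospart_subgradients X g dg dgpos).
Context (F1 F2 : R) (F1_ge0 : 0 <= F1) (F2_ge0 : 0 <= F2).
Context (g_le : forall i t x, (0 < t)%N -> X x -> enorm (g i t x) <= F1).
Context (df_le : forall i t x, (0 < t)%N -> X x -> enorm (df i t x) <= F2).
Context (dg_le : forall i t x, (0 < t)%N -> X x -> specnorm (dg i t x) <= F2).
Context (alpha beta gamma tau : nat -> R).
Context (alpha_gt0 : forall t, (0 < t)%N -> 0 < alpha t)
  (alpha_noninc : forall t, (0 < t)%N -> alpha t.+1 <= alpha t)
  (beta_gt0 : forall t, (0 < t)%N -> 0 < beta t)
  (beta_noninc : forall t, (0 < t)%N -> beta t.+1 <= beta t)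
  (gamma_gt0 : forall t, (0 < t)%N -> 0 < gamma t)
  (beta_gamma_le1 : forall t, (0 < t)%N -> beta t * gamma t <= 1)
  (gamma_step : forall t, (0 < t)%N ->
     (1 - beta t.+1 * gamma t.+1) / gamma t.+1 <= (gamma t)^-1)
  (tau_ge0 : forall t, (0 < t)%N -> 0 <= tau t)
  (tau_le1 : forall t, (0 < t)%N -> tau t <= 1).
Context (x xhat z omega : 'I_n -> nat -> 'cV[R]_p)
  (q : forall i : 'I_n, nat -> 'cV[R]_(m i)).
Context (run : algorithm_run X g df dgpos W alpha beta gamma tau x xhat z omega q).
Context (c : R) (c_ge : forall i, enorm (const_mx 1 : 'cV[R]_(m i)) <= c).
Context (Cc : R).
Context (consensus : forall (x : 'I_n -> nat -> 'cV[R]_p) (e : nat -> R) (M : R),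
    (forall t, (0 < t)%N -> \sum_i enorm (x i t.+1 - \sum_j W t i j *: x j t) <= e t) ->
    (forall t, (0 < t)%N -> deviation (x^~ t) <= M) ->
    forall T, \sum_(t < T) deviation (x^~ t.+1) <= Cc * (M + \sum_(t < T) e t.+1)).

Let G := F1 + 2 * RX * F2.
Let eps t := \sum_i enorm (x i t.+1 - z i t.+1).

Let X_neq0 : X !=set0.
Proof. by exists (x (Ordinal n_gt0) 1%N); exact: run_init_x run _. Qed.

Lemma run_in i t : (0 < t)%N -> X (x i t).
Proof.
case: t => // -[_|t _]; first exact: run_init_x run _.
by rewrite (run_x run)//; exact: eproj_in X_bounded _.
Qed.

Lemma RX_ge0 : 0 <= RX.
Proof. by case: X_neq0 => y /X_bounded; apply: le_trans; exact: enorm_ge0. Qed.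

Lemma dist_in_le u v : X u -> X v -> enorm (u - v) <= 2 * RX.
Proof.
move=> /X_bounded Xu /X_bounded Xv; apply: le_trans (ler_enormB _ _) _; lra.
Qed.

Lemma run_q_ge0 i t k : (0 < t)%N -> 0 <= q i t k 0.
Proof.
case: t => // -[_|t _]; first by rewrite (run_init_q run) mxE.
by rewrite (run_q run)// pospart_ge0.
Qed.

Lemma run_xhat_near i t : (0 < t)%N -> enorm (xhat i t - x i t) <= tau t.
Proof.
case: t => // -[_|t _].
  by rewrite (run_init_xhat run) subrr enorm0 tau_ge0.
rewrite (run_xhat run)//; case: ifPn => [_|]; first by rewrite subrr enorm0 tau_ge0.
by rewrite -ltNge enorm_distC => /ltW.
Qed.

(** After multiplication by the new [beta], the dual recursion is bounded by a convex combination,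
    with weight [beta * gamma], of [G] and of the previous scaled norm, itself at most [G] since
    [beta] does not increase. *)
Lemma run_q_le i t : (0 < t)%N -> beta t * enorm (q i t) <= G.
Proof.
have G_ge0 : 0 <= G by rewrite /G addr_ge0// !mulr_ge0// RX_ge0.
elim: t => // -[_ _|t IHt _].
  by rewrite (run_init_q run) enorm0 mulr0.
have t1 := ltn0Sn t; have t2 := ltn0Sn t.+1; have Xx := run_in i t1.
have := dual_growth X_neq0 X_closed X_bounded (df i t.+1 (x i t.+1)) F2_ge0 Xx
  (@g_le i _ _ t1 Xx) (@dg_le i _ _ t1 Xx) (@gpos_sub i _ _ t1 Xx) (z i t.+2) (q i t.+1)
  (alpha t.+2) (gamma_gt0 t2) (beta_gamma_le1 t2).
rewrite -(run_omega run)// -(run_x run)// -(run_q run)// -/G => qS.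
have b0 := beta_gt0 t2.
have bg : 0 <= 1 - beta t.+2 * gamma t.+2 by rewrite subr_ge0 beta_gamma_le1.
have bq : beta t.+2 * enorm (q i t.+1) <= G.
  apply: le_trans (IHt isT); rewrite ler_wpM2r ?enorm_ge0//; exact: beta_noninc.
have := ler_wpM2l (ltW b0) qS; have := ler_wpM2l bg bq; lra.
Qed.

Lemma run_step i t y N : (0 < t)%N -> X y -> nonpos (g i t y) -> 0 <= N ->
  f i t (x i t) - f i t y + N * enorm (pospart (g i t (x i t)))
    + (enorm (q i t.+1 - const_mx N) ^+ 2
       - (1 - beta t.+1 * gamma t.+1) * enorm (q i t - const_mx N) ^+ 2) / (2 * gamma t.+1)
  <= F2 * (1 + N * c) * enorm (x i t.+1 - x i t)
    + (enorm (z i t.+1 - y) ^+ 2 - enorm (x i t.+1 - y) ^+ 2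
       - enorm (x i t.+1 - z i t.+1) ^+ 2) / (2 * alpha t.+1)
    + beta t.+1 * (N * c) ^+ 2 / 2 + gamma t.+1 * (2 * G ^+ 2).
Proof.
move=> t0 Xy gy N0; have Xx := run_in i t0.
have bq : beta t.+1 * enorm (q i t) <= G.
  by apply: le_trans (run_q_le i t0); rewrite ler_wpM2r ?enorm_ge0// beta_noninc.
have tS := ltn0Sn t.
have := agent_step X_neq0 X_convex X_closed X_bounded F2_ge0
  Xx (@f_sub i _ _ t0 Xx) (@df_le i _ _ t0 Xx) (@g_le i _ _ t0 Xx) (@dg_le i _ _ t0 Xx)
  (fun k => @g_sub i _ _ k t0 Xx) (@gpos_sub i _ _ t0 Xx) (z i t.+1)
  (fun k => run_q_ge0 k t0) (alpha_gt0 tS) (ltW (beta_gt0 tS)) (gamma_gt0 tS)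
  Xy gy N0 bq.
rewrite -(run_omega run)// -(run_x run)// -(run_q run)// -/G => /le_trans; apply.
have Nc0 : 0 <= N * enorm (const_mx 1 : 'cV[R]_(m i)) by rewrite mulr_ge0// enorm_ge0.
have Nc : N * enorm (const_mx 1 : 'cV[R]_(m i)) <= N * c by rewrite ler_wpM2l.
rewrite lerD2r; apply: lerD; last first.
  rewrite ler_wpM2r ?invr_ge0// ler_wpM2l ?(ltW (beta_gt0 _))//.
  by rewrite ler_pXn2r ?nnegrE// (le_trans Nc0 Nc).
by rewrite lerD2r ler_wpM2r ?enorm_ge0// ler_wpM2l// lerD2l.
Qed.

(** Mixing does not increase the sum of squares. Replacing [xhat] by [x] costs [2 b s + s^2] with
    distance [b <= 2 RX] and error [s <= tau t <= 1], whence the factor [4 RX + 1]. *)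
Lemma run_mix t y : (0 < t)%N -> X y ->
  \sum_i enorm (z i t.+1 - y) ^+ 2 <=
    \sum_i enorm (x i t - y) ^+ 2 + n%:R * (tau t * (4 * RX + 1)).
Proof.
move=> t0 Xy; have [_ Ar _] := Wds t0.
have zE i : z i t.+1 - y = \sum_j W t i j *: (xhat j t - y).
  rewrite (run_z run)// (eq_bigr _ (fun j _ => scalerBr _ _ _)) sumrB.
  by rewrite -scaler_suml Ar scale1r.
under eq_bigr do rewrite zE.
apply: le_trans (sum_sqr_enorm_stochastic _ (Wds t0)) _.
rewrite -sum_const_natmul -big_split; apply: ler_sum => j _ /=.
have := ler_dist_enormD (xhat j t) (x j t) y; have := run_xhat_near j t0.
have := dist_in_le (run_in j t0) Xy.
move: (enorm_ge0 (xhat j t - y)) (enorm_ge0 (x j t - y)) (tau_ge0 t0) (tau_le1 t0).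
move: (enorm (xhat j t - y)) (enorm (x j t - y)) (enorm (xhat j t - x j t)) (tau t).
move=> a b d s a0 b0 s0 s1 b2 ds abd.
have ab : a <= b + s by lra.
have := ler_pM a0 a0 ab ab; have := ler_wpM2l s0 b2; have := ler_wpM2l s0 s1; lra.
Qed.

Lemma run_z_mean t : (0 < t)%N ->
  \sum_i enorm (z i t.+1 - \sum_j W t i j *: x j t) <= n%:R * tau t.
Proof.
move=> t0; apply: (@le_trans _ _ (\sum_i enorm (\sum_j W t i j *: (xhat j t - x j t)))).
  apply: ler_sum => i _; rewrite (run_z run)// -sumrB.
  by under [X in enorm X <= _]eq_bigr do rewrite -scalerBr.
have := sum_enorm_stochastic (fun j => xhat j t - x j t) (Wds t0).
move=> /le_trans; apply.
apply: sum_le_natmul => j.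
exact: run_xhat_near.
Qed.

(** The route goes through [z], the mixture of the exact states and the mean. The deviation counts
    twice because mixing does not increase it. *)
Lemma run_move t : (0 < t)%N ->
  \sum_i enorm (x i t.+1 - x i t) <= eps t + n%:R * tau t + 2 * deviation (x^~ t).
Proof.
move=> t0; have Wt := Wds t0.
have dW := sum_enorm_stochastic (fun i => x i t - mean (x^~ t)) Wt.
apply: le_trans (_ : _ <= eps t + \sum_i enorm (z i t.+1 - \sum_j W t i j *: x j t) +
  (\sum_i enorm (\sum_j W t i j *: (x j t - mean (x^~ t))) + deviation (x^~ t))) _.
  rewrite -!big_split; apply: ler_sum => i _ /=.
  rewrite -stochastic_sub_mean// (enorm_distC (x i t)).
  apply: le_trans (ler_dist_enormD _ (z i t.+1) _) _; rewrite -addrA lerD2l.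
  apply: le_trans (ler_dist_enormD _ (\sum_j W t i j *: x j t) _) _; rewrite lerD2l.
  exact: ler_dist_enormD.
by rewrite -/(deviation _) in dW; have := run_z_mean t0; lra.
Qed.

Lemma run_deviation_le t : (0 < t)%N -> deviation (x^~ t) <= n%:R * (2 * RX).
Proof.
move=> t0; apply: sum_le_natmul => i.
have n0 : n%:R != 0 :> R by rewrite pnatr_eq0 -lt0n.
have -> : x i t - mean (x^~ t) = n%:R^-1 *: \sum_j (x i t - x j t).
  rewrite sumrB sumr_const card_ord -[x i t *+ n]scaler_nat scalerBr scalerA mulVf//.
  by rewrite scale1r.
rewrite enormZ ger0_norm ?invr_ge0// ler_pdivrMl ?ltr0n//.
apply: le_trans (ler_enorm_sum _) _.
apply: sum_le_natmul => j.
by apply: dist_in_le; exact: run_in.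
Qed.

Lemma run_sum_deviation T : \sum_(t < T) deviation (x^~ t.+1) <=
  Cc * (n%:R * (2 * RX) + \sum_(t < T) (eps t.+1 + n%:R * tau t.+1)).
Proof.
apply: (consensus (e := fun t => eps t + n%:R * tau t)); last exact: run_deviation_le.
move=> t t0; apply: le_trans (lerD (lexx _) (run_z_mean t0)).
rewrite -big_split; apply: ler_sum => i _; exact: ler_dist_enormD.
Qed.

(** * Summation against a comparator sequence *)

Section Comparator.
Context (T : nat) (T_gt0 : (0 < T)%N) (y : nat -> 'cV[R]_p).
Context (y_in : forall t, (0 < t)%N -> X (y t)).
Context (y_feasible : forall i t, (0 < t <= T)%N -> nonpos (g i t (y t))).
Context (N K : R) (N_ge0 : 0 <= N) (K_ge0 : 0 <= K).

Let loss t := \sum_i (f i t (x i t) - f i t (y t)).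
Let violation t := \sum_i enorm (pospart (g i t (x i t))).
Let V t := \sum_i enorm (x i t - y t) ^+ 2.
Let Q t := \sum_i enorm (q i t - const_mx N) ^+ 2.
(** The total weight that falls on the sum of [eps]: the movement uses it directly and through twice
    the deviation, and the weight [K] uses it through the deviation. *)
Let J := F2 * (1 + N * c) * (1 + 2 * Cc) + K * Cc.
Let r t := (2 * alpha t.+1)^-1.
Let jump t := n%:R * (4 * RX * enorm (y t.+1 - y t) + (4 * RX + 1) * tau t).

Let r_step t : (0 < t)%N -> 0 <= r t <= r t.+1.
Proof.
move=> t0; have a1 := alpha_gt0 (ltn0Sn t); have a2 := alpha_gt0 (ltn0Sn t.+1).
rewrite invr_ge0 mulr_ge0 ?(ltW a1)//= lef_pV2 ?posrE ?mulr_gt0//.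
by rewrite ler_pM2l// alpha_noninc.
Qed.

Let comparator_shift t : (0 < t)%N ->
  V t.+1 - n%:R * (4 * RX * enorm (y t.+1 - y t)) <= \sum_i enorm (x i t.+1 - y t) ^+ 2.
Proof.
move=> t0; rewrite lerBlDr -sum_const_natmul -big_split.
apply: ler_sum => i _ /=; have xS := run_in i (ltn0Sn t).
have := ler_sqr_dist_enorm (dist_in_le xS (y_in (ltn0Sn t))) (dist_in_le xS (y_in t0)).
lra.
Qed.

(** [J * eps t] is placed on the left so that, once summed, it cancels the bounds on movement and
    disagreement. *)
Let step t : (0 < t <= T)%N ->
  loss t + N * violation t + (Q t.+1 - (1 - beta t.+1 * gamma t.+1) * Q t) * (2 * gamma t.+1)^-1
    + J * eps t
  <= F2 * (1 + N * c) * (\sum_i enorm (x i t.+1 - x i t)) + r t * (V t - V t.+1) + r t * jump t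
    + n%:R * (N * c) ^+ 2 / 2 * beta t.+1 + 2 * n%:R * G ^+ 2 * gamma t.+1
    + n%:R * J ^+ 2 / 2 * alpha t.+1.
Proof.
move=> tT; have /andP[t0 _] := tT; have a0 := alpha_gt0 (ltn0Sn t).
have r0 : 0 < r t by rewrite invr_gt0 mulr_gt0.
(* Young's inequality as a perfect square, using [2 * r t * alpha t.+1 = 1]. *)
have young e : J * e <= e ^+ 2 * r t + J ^+ 2 / 2 * alpha t.+1.
  rewrite -subr_ge0 (_ : _ - _ = r t * (e - J * alpha t.+1) ^+ 2); last first.
    by rewrite /r; field; rewrite gt_eqF.
  by rewrite mulr_ge0 ?sqr_ge0// ltW.
have := ler_sum (index_enum 'I_n) (P := xpredT) (fun i _ => run_step t0 (y_in t0) (@y_feasible i t tT) N_ge0).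
have := ler_sum (index_enum 'I_n) (P := xpredT) (fun i _ => young (enorm (x i t.+1 - z i t.+1))).
rewrite -/(r t) !big_split/= -!mulr_suml -!mulr_sumr !sum_const_natmul.
rewrite !big_split/= !sumrN -!mulr_sumr -/(Q t) -/(Q t.+1) -/(violation t).
have := ler_wpM2l (ltW r0) (comparator_shift t0).
have := ler_wpM2l (ltW r0) (run_mix t0 (y_in t0)).
rewrite -/(V t) /jump /loss !big_split/= sumrN /eps.
lra.
Qed.

(** No dual variable survives on the right: the telescoped sum leaves only [Q 1 / (2 gamma 1)],
    which is known because [q] starts at zero. *)
Lemma run_bound :
  \sum_(t < T) \sum_i (f i t.+1 (x i t.+1) - f i t.+1 (y t.+1))
    + N * (\sum_(t < T) \sum_i enorm (pospart (g i t.+1 (x i t.+1))))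
    + K * (\sum_(t < T) deviation (x^~ t.+1))
  <= n%:R * (N * c) ^+ 2 / 2 * ((gamma 1%N)^-1 + \sum_(t < T) beta t.+2)
    + 2 * n%:R * G ^+ 2 * (\sum_(t < T) gamma t.+2)
    + r T * (n%:R * (2 * RX) ^+ 2 + n%:R * (4 * RX * (\sum_(t < T) enorm (y t.+2 - y t.+1))
             + (4 * RX + 1) * (\sum_(t < T) tau t.+1)))
    + J * (n%:R * (2 * RX) + n%:R * (\sum_(t < T) tau t.+1))
    + n%:R * J ^+ 2 / 2 * (\sum_(t < T) alpha t.+2).
Proof.
have RX0 := RX_ge0.
have stepS (t : 'I_T) := step (t := t.+1) (ltn_ord t).
have := ler_sum (index_enum 'I_T) (P := xpredT) (fun t _ => stepS t).
rewrite !big_split/= -!mulr_sumr.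
have -> : \sum_(t < T) \sum_i (f i t.+1 (x i t.+1) - f i t.+1 (y t.+1)) =
  \sum_(t < T) loss t.+1 by [].
have -> : \sum_(t < T) \sum_i enorm (pospart (g i t.+1 (x i t.+1))) =
  \sum_(t < T) violation t.+1 by [].
have VM t : (0 < t)%N -> 0 <= V t <= n%:R * (2 * RX) ^+ 2.
  move=> t0; rewrite sumr_ge0 => [|i _]; last exact: sqr_ge0.
  apply: sum_le_natmul => i; rewrite ler_pXn2r ?nnegrE ?enorm_ge0 ?mulr_ge0//.
  exact: dist_in_le (run_in i t0) (y_in t0).
have := sum_weighted_telescope T_gt0 r_step VM.
have jump0 t : (0 < t)%N -> 0 <= jump t.
  by move=> t0; rewrite !mulr_ge0// addr_ge0// !mulr_ge0 ?enorm_ge0 ?addr_ge0 ?tau_ge0 ?mulr_ge0.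
have := sum_weighted_le T r_step jump0.
have -> : \sum_(t < T) jump t.+1 = n%:R * (4 * RX * (\sum_(t < T) enorm (y t.+2 - y t.+1))
             + (4 * RX + 1) * (\sum_(t < T) tau t.+1)).
  by rewrite /jump -mulr_sumr big_split/= -!mulr_sumr.
have Q0 t : (0 < t)%N -> 0 <= Q t by move=> _; apply: sumr_ge0 => i _; exact: sqr_ge0.
have h0 t : (0 < t)%N -> 0 <= (2 * gamma t)^-1.
  by move=> t0; rewrite invr_ge0 mulr_ge0// ltW// gamma_gt0.
have ah t : (0 < t)%N ->
    (1 - beta t.+1 * gamma t.+1) * (2 * gamma t.+1)^-1 <= (2 * gamma t)^-1.
  by move=> /gamma_step; rewrite !invfM; lra.
have := sum_dual_telescope (a := fun t => 1 - beta t * gamma t) T Q0 h0 ah.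
have Q1 : Q 1%N <= n%:R * (N * c) ^+ 2.
  apply: sum_le_natmul => i; rewrite (run_init_q run) sub0r enormN enorm_const_mx//.
  have Nc0 : 0 <= N * enorm (const_mx 1 : 'cV[R]_(m i)) by rewrite mulr_ge0// enorm_ge0.
  have Nc : N * enorm (const_mx 1 : 'cV[R]_(m i)) <= N * c by rewrite ler_wpM2l.
  by rewrite ler_pXn2r ?nnegrE// (le_trans Nc0 Nc).
have g1 := gamma_gt0 (ltn0Sn 0).
have := ler_wpM2r (h0 1%N isT) Q1; rewrite invfM.
have c0 : 0 <= c by apply: le_trans (c_ge (Ordinal n_gt0)); exact: enorm_ge0.
have L0 : 0 <= F2 * (1 + N * c) by rewrite mulr_ge0// addr_ge0// mulr_ge0.
have move_sum : \sum_(t < T) \sum_i enorm (x i t.+2 - x i t.+1) <=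
    \sum_(t < T) eps t.+1 + n%:R * (\sum_(t < T) tau t.+1)
      + 2 * (\sum_(t < T) deviation (x^~ t.+1)).
  rewrite !mulr_sumr -!big_split; apply: ler_sum => t _; exact: run_move.
have := ler_wpM2l L0 move_sum.
(* With [L0 = F2 (1 + N c)], the disagreement has weight [2 L0] from the movement plus [K];
   multiplied by [Cc] and joined with the direct weight [L0], this is exactly [J]. *)
have LK0 : 0 <= 2 * (F2 * (1 + N * c)) + K by rewrite addr_ge0// mulr_ge0.
have := ler_wpM2l LK0 (run_sum_deviation T).
rewrite big_split/= -mulr_sumr.
have := mulr_ge0 L0 (mulr_ge0 (ler0n R n) (mulr_ge0 (ler0n R 2) RX0)).
rewrite /J; lra.
Qed.

End Comparator.

(** The subgradient of [f j] at [x i] bounds the price of moving each loss from [x i] back to [x j],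
    where the algorithm controls it. *)
Lemma net_reg_le T (y : nat -> 'cV[R]_p) :
  net_reg f x y T <= n%:R^-1 *
    (\sum_(t < T) \sum_i (f i t.+1 (x i t.+1) - f i t.+1 (y t.+1))
     + 2 * F2 * (\sum_(t < T) deviation (x^~ t.+1))).
Proof.
have n0 : n%:R != 0 :> R by rewrite pnatr_eq0 -lt0n.
rewrite /net_reg exchange_big/= !big_add1 !big_mkord mulr_sumr -sumrB.
rewrite [in leRHS]mulr_sumr -big_split/= [in leRHS]mulr_sumr; apply: ler_sum => t _.
have x_in i := run_in i (ltn0Sn t).
rewrite /global_loss -mulrBr ler_pM2l ?invr_gt0 ?ltr0n//.
rewrite -mulr_sumr sumrB addrAC lerD2r ler_pdivrMl ?ltr0n//.
apply: (@le_trans _ _ (\sum_(i < n) \sum_j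
    (f j t.+1 (x j t.+1) + F2 * enorm (x i t.+1 - x j t.+1)))).
  apply: ler_sum => i _; apply: ler_sum => j _.
  have := f_sub j (ltn0Sn t) (x_in i) (x_in j).
  have := inner_le (- df j t.+1 (x i t.+1)) (x j t.+1 - x i t.+1).
  rewrite innerNl enormN enorm_distC.
  have := ler_wpM2r (enorm_ge0 (x i t.+1 - x j t.+1)) (df_le j (ltn0Sn t) (x_in i)).
  lra.
under [leLHS]eq_bigr do rewrite big_split/= -mulr_sumr.
rewrite big_split/= sum_const_natmul -mulr_sumr mulrDr lerD2l.
have := ler_wpM2l F2_ge0 (sum_dist_le_deviation (x^~ t.+1)); lra.
Qed.

Lemma net_ccv_le T : net_ccv g x T <=
    \sum_(t < T) \sum_i enorm (pospart (g i t.+1 (x i t.+1)))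
    + 2 * F2 * (\sum_(t < T) deviation (x^~ t.+1)).
Proof.
rewrite /net_ccv exchange_big/= !big_add1 !big_mkord mulr_sumr.
rewrite [in leRHS]mulr_sumr -big_split/=; apply: ler_sum => t _.
have x_in i := run_in i (ltn0Sn t).
rewrite ler_pdivrMl ?ltr0n//.
apply: (@le_trans _ _ (\sum_(i < n) \sum_j
    (enorm (pospart (g j t.+1 (x j t.+1))) + F2 * enorm (x i t.+1 - x j t.+1)))).
  apply: ler_sum => i _; apply: le_trans (enorm_pospart_mxcol _) _.
  apply: ler_sum => j _.
  exact: (enorm_pospart_lipschitz F2_ge0 (@dg_le j _ _ (ltn0Sn t) (x_in i))
    (fun k => @g_sub j _ _ k (ltn0Sn t) (x_in i))
    (@gpos_sub j _ _ (ltn0Sn t) (x_in i)) (x_in j)).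
under [leLHS]eq_bigr do rewrite big_split/= -mulr_sumr.
rewrite big_split/= sum_const_natmul -mulr_sumr mulrDr lerD2l.
have := ler_wpM2l F2_ge0 (sum_dist_le_deviation (x^~ t.+1)); lra.
Qed.

End Run.

(** * Step sizes *)

Section StepSizes.
Context (R : realType) (kappa c : R) (alpha beta gamma tau Psi : nat -> R).
Context (kappa01 : 0 < kappa < 1) (c_gt1 : 1 < c)
    (tauE : forall t, (0 < t)%N -> tau t = 1 / c ^+ t)
    (PsiE : forall t, (0 < t)%N -> Psi t = \sum_(1 <= s < t.+1) tau s)
    (alphaE : forall t, (0 < t)%N -> alpha t = Num.sqrt (Psi t / t%:R))
    (betaE : forall t, (0 < t)%N -> beta t = 1 / t%:R `^ kappa)
    (gammaE : forall t, (0 < t)%N -> gamma t = 1 / t%:R `^ (1 - kappa)).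

Let c_gt0 : 0 < c. Proof. exact: lt_trans c_gt1. Qed.
Let kappa_gt0 : 0 < kappa. Proof. by case/andP: kappa01. Qed.
Let kappa_lt1 : kappa < 1. Proof. by case/andP: kappa01. Qed.

Lemma PsiE_ord t : (0 < t)%N -> Psi t = \sum_(s < t) tau s.+1.
Proof. by move=> t0; rewrite PsiE// big_add1 big_mkord. Qed.

Lemma tau_gt0 t : (0 < t)%N -> 0 < tau t.
Proof. by move=> t0; rewrite tauE// divr_gt0// exprn_gt0. Qed.

Lemma tau_le1 t : (0 < t)%N -> tau t <= 1.
Proof.
by move=> t0; rewrite tauE// ler_pdivrMr ?exprn_gt0// mul1r exprn_ege1// ltW.
Qed.

Lemma tau_noninc s t : (0 < s <= t)%N -> tau t <= tau s.
Proof.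
move=> /andP[s0 st]; rewrite !tauE// ?(leq_trans s0)//.
by rewrite !div1r lef_pV2 ?posrE ?exprn_gt0// ler_weXn2l// ltW.
Qed.

Lemma sum_tau_le T : \sum_(t < T) tau t.+1 <= 1 / (c - 1).
Proof.
have c1 : 0 < c - 1 by rewrite subr_gt0.
(* The exact value of the geometric sum is what the induction carries. *)
apply: (@le_trans _ _ ((1 - 1 / c ^+ T) / (c - 1))); last first.
  by rewrite ler_pM2r ?invr_gt0// lerBlDr lerDl divr_ge0// exprn_ge0// ltW.
elim: T => [|T IHT]; first by rewrite big_ord0 expr0 divr1 subrr mul0r.
rewrite big_ord_recr/=; apply: le_trans (lerD IHT (lexx _)) _.
rewrite tauE// le_eqVlt; apply/orP; left; apply/eqP.
have cT : c ^+ T != 0 by rewrite expf_neq0// gt_eqF.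
by rewrite exprS; field; rewrite cT (gt_eqF c1) (gt_eqF c_gt0).
Qed.

Lemma Psi_ge t : (0 < t)%N -> 1 / c <= Psi t.
Proof.
move=> t0; rewrite PsiE_ord//; case: t t0 => // t _.
rewrite big_ord_recl/= tauE// expr1 lerDl; apply: sumr_ge0 => s _.
exact/ltW/tau_gt0.
Qed.

Lemma Psi_gt0 t : (0 < t)%N -> 0 < Psi t.
Proof. by move=> t0; apply: lt_le_trans (Psi_ge t0); rewrite divr_gt0. Qed.

Lemma alpha_gt0 t : (0 < t)%N -> 0 < alpha t.
Proof. by move=> t0; rewrite alphaE// sqrtr_gt0 divr_gt0 ?ltr0n// Psi_gt0. Qed.

(** [Psi t / t] is the average of the first [t] thresholds, and averages of a non-increasing
    sequence do not increase. *)
Lemma alpha_noninc t : (0 < t)%N -> alpha t.+1 <= alpha t.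
Proof.
move=> t0; rewrite !alphaE//; apply: ler_wsqrtr.
rewrite ler_pdivrMr ?ltr0n// mulrAC ler_pdivlMr ?ltr0n//.
have PsiS : Psi t.+1 = Psi t + tau t.+1 by rewrite !PsiE_ord// big_ord_recr.
have tPsi : t%:R * tau t.+1 <= Psi t.
  rewrite PsiE_ord// -sum_const_natmul; apply: ler_sum => s _.
  by apply: tau_noninc; rewrite /= ltnS ltnW.
by rewrite PsiS -natr1; lra.
Qed.

Lemma inv_alpha_le t : (0 < t)%N -> (alpha t)^-1 <= Num.sqrt c * t%:R `^ 2^-1.
Proof.
move=> t0; rewrite powR12_sqrt// -sqrtrM ?(ltW c_gt0)// alphaE// -sqrtrV; last first.
  by rewrite divr_ge0// ltW// Psi_gt0.
apply: ler_wsqrtr; rewrite invf_div mulrC ler_wpM2r//.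
by rewrite -[leRHS]invrK lef_pV2 ?posrE ?invr_gt0 ?Psi_gt0// -div1r Psi_ge.
Qed.

Lemma sum_alpha_le T :
  \sum_(t < T) alpha t.+2 <= 2 * Num.sqrt (1 / (c - 1)) * T%:R `^ 2^-1.
Proof.
have alpha_le t : (0 < t)%N -> alpha t <= Num.sqrt (1 / (c - 1)) * t%:R `^ (2^-1 - 1).
  move=> t0; rewrite (_ : 2^-1 - 1 = - 2^-1 :> R); last by field.
  rewrite powRN powR12_sqrt// -sqrtrV// -sqrtrM ?divr_ge0 ?subr_ge0 ?(ltW c_gt1)//.
  rewrite alphaE//; apply: ler_wsqrtr; rewrite ler_wpM2r ?invr_ge0//.
  by rewrite PsiE_ord// sum_tau_le.
apply: (@le_trans _ _ (\sum_(t < T) Num.sqrt (1 / (c - 1)) * t.+1%:R `^ (2^-1 - 1))).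
  by apply: ler_sum => t _; apply: le_trans (alpha_noninc _) (alpha_le _ _).
rewrite -mulr_sumr; have half01 : 0 < (2^-1 : R) <= 1 by lra.
have := ler_wpM2l (sqrtr_ge0 (1 / (c - 1))) (sum_powR_le T half01).
by rewrite invrK; lra.
Qed.

Let powR_nat_gt0 t a : (0 < t)%N -> 0 < t%:R `^ a :> R.
Proof. by move=> t0; rewrite powR_gt0// ltr0n. Qed.

Lemma beta_gt0 t : (0 < t)%N -> 0 < beta t.
Proof. by move=> t0; rewrite betaE// divr_gt0// powR_nat_gt0. Qed.

Lemma gamma_gt0 t : (0 < t)%N -> 0 < gamma t.
Proof. by move=> t0; rewrite gammaE// divr_gt0// powR_nat_gt0. Qed.

Lemma beta_noninc t : (0 < t)%N -> beta t.+1 <= beta t.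
Proof.
move=> t0; rewrite !betaE// !div1r lef_pV2 ?posrE ?powR_nat_gt0//.
by rewrite ge0_ler_powR ?nnegrE ?ler_nat// ltW.
Qed.

Lemma gamma_noninc t : (0 < t)%N -> gamma t.+1 <= gamma t.
Proof.
move=> t0; rewrite !gammaE// !div1r lef_pV2 ?posrE ?powR_nat_gt0//.
by rewrite ge0_ler_powR ?nnegrE ?ler_nat// subr_ge0 ltW.
Qed.

Lemma beta_gammaE t : (0 < t)%N -> beta t * gamma t = t%:R^-1.
Proof.
move=> t0; rewrite betaE// gammaE// !div1r -invfM -powRD; last first.
  by rewrite pnatr_eq0 -lt0n t0 implybT.
by rewrite addrC subrK powRr1.
Qed.

Lemma beta_gamma_le1 t : (0 < t)%N -> beta t * gamma t <= 1.
Proof. by move=> t0; rewrite beta_gammaE// invf_le1 ?ltr0n// ler1n. Qed.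

(** Because [beta t * gamma t = 1 / t], the two sides are [t * beta t.+1] and [t * beta t]. *)
Lemma gamma_step t : (0 < t)%N ->
  (1 - beta t.+1 * gamma t.+1) / gamma t.+1 <= (gamma t)^-1.
Proof.
move=> t0; have bg := beta_gammaE (ltn0Sn t).
have t1 : t.+1%:R != 0 :> R by rewrite pnatr_eq0.
have -> : (1 - beta t.+1 * gamma t.+1) / gamma t.+1 = t%:R * beta t.+1.
  have -> : 1 - beta t.+1 * gamma t.+1 = t%:R * (beta t.+1 * gamma t.+1).
    by rewrite bg; move: t1; rewrite -natr1 => t1; field.
  by rewrite mulrA mulfK// gt_eqF// gamma_gt0.
have -> : (gamma t)^-1 = t%:R * beta t.
  have := beta_gammaE t0; have g0 := gamma_gt0 t0 => bgt.
  have t00 : t%:R != 0 :> R by rewrite pnatr_eq0 -lt0n.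
  by rewrite -[t%:R]invrK -bgt; field; rewrite !gt_eqF// beta_gt0.
by rewrite ler_wpM2l// beta_noninc.
Qed.

Lemma sum_beta_le T : \sum_(t < T) beta t.+2 <= T%:R `^ (1 - kappa) / (1 - kappa).
Proof.
have k01 : 0 < 1 - kappa <= 1 by rewrite subr_gt0 kappa_lt1 lerBlDr lerDl ltW.
apply: le_trans (sum_powR_le T k01); apply: ler_sum => t _.
apply: le_trans (beta_noninc _) _ => //; rewrite betaE// div1r -powRN.
by rewrite addrAC subrr sub0r.
Qed.

Lemma sum_gamma_le T : \sum_(t < T) gamma t.+2 <= T%:R `^ kappa / kappa.
Proof.
have k01 : 0 < kappa <= 1 by rewrite kappa_gt0 ltW.
apply: le_trans (sum_powR_le T k01); apply: ler_sum => t _.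
apply: le_trans (gamma_noninc _) _ => //; rewrite gammaE// div1r -powRN.
by rewrite opprB.
Qed.

End StepSizes.

(** * The regret and violation rates *)

Theorem corollary2 (R : realType) (n p : nat) (n_gt0 : (0 < n)%N)
    (m : 'I_n -> nat)
    (X : set 'cV[R]_p)
    (f : 'I_n -> nat -> 'cV[R]_p -> R)
    (g : forall i : 'I_n, nat -> 'cV[R]_p -> 'cV[R]_(m i))
    (df : 'I_n -> nat -> 'cV[R]_p -> 'cV[R]_p)
    (dg dgpos : forall i : 'I_n, nat -> 'cV[R]_p -> 'M[R]_(p, m i))
    (E : nat -> rel 'I_n) (W : nat -> 'M[R]_n)
    (kappa c : R) (alpha beta gamma tau Psi : nat -> R)
    (feasible_neq0 : forall T, (0 < T)%N -> feasible X g T !=set0)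
    (static_feasible_neq0 : forall T, (0 < T)%N -> static_feasible X g T !=set0)
    (A1 : assumption1 X f g df dg dgpos)
    (EW : mixing E W)
    (A2 : assumption2 E W)
    (A3 : assumption3 tau)
    (kappa01 : 0 < kappa < 1) (c_gt1 : 1 < c)
    (tauE : forall t, (0 < t)%N -> tau t = 1 / c ^+ t)
    (PsiE : forall t, (0 < t)%N -> Psi t = \sum_(1 <= s < t.+1) tau s)
    (alphaE : forall t, (0 < t)%N -> alpha t = Num.sqrt (Psi t / t%:R))
    (betaE : forall t, (0 < t)%N -> beta t = 1 / t%:R `^ kappa)
    (gammaE : forall t, (0 < t)%N -> gamma t = 1 / t%:R `^ (1 - kappa)) :
  exists (C : R) (T0 : nat), 0 < C /\
    forall (x xhat z omega : 'I_n -> nat -> 'cV[R]_p)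
      (q : forall i : 'I_n, nat -> 'cV[R]_(m i)),
    algorithm_run X g df dgpos W alpha beta gamma tau x xhat z omega q ->
    forall T : nat, (0 < T)%N -> (T0 <= T)%N ->
      (forall y : nat -> 'cV[R]_p, feasible X g T y ->
         net_reg f x y T <=
           C * (T%:R `^ Num.max kappa (1 / 2)
                + T%:R `^ (1 / 2) * path_length y T)) /\
      net_ccv g x T <= C * T%:R `^ Num.max (1 - kappa / 2) (3 / 4).
Proof.
have [[Xcvx Xcl [RX [RX_gt0 X_le]]] [_ _ [F1 [F1_gt0 fg_le]]]
  [f_sub g_sub [F2 [F2_gt0 dfg_le]]] gpos_sub] := A1.
have g_le i t x t0 Xx := (fg_le i t t0).2 x Xx.
have df_le i t x t0 Xx := (dfg_le i t x t0 Xx).1.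
have dg_le i t x t0 Xx := (dfg_le i t x t0 Xx).2.
have [_ Wds _] := A2.
have [Cc [Cc_ge0 consensus]] := sum_deviation_le p n_gt0 EW A2.
pose cm : R := \sum_i enorm (const_mx 1 : 'cV[R]_(m i)).
have cm_ge i : enorm (const_mx 1 : 'cV[R]_(m i)) <= cm.
  by rewrite /cm (bigD1 i)//= lerDl sumr_ge0// => j _; exact: enorm_ge0.
have cm_ge0 : 0 <= cm by apply: sumr_ge0 => i _; exact: enorm_ge0.
have /andP[kappa_gt0 kappa_lt1] := kappa01.
have F1_ge0 := ltW F1_gt0; have F2_ge0 := ltW F2_gt0; have RX_ge0 := ltW RX_gt0.
have c_ge0 : 0 <= c by apply: ltW; exact: lt_trans c_gt1.
have b_ge0 : 0 <= (1 - kappa)^-1 by rewrite invr_ge0 subr_ge0 ltW.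
have k_ge0 : 0 <= kappa^-1 by rewrite invr_ge0 ltW.
have a_ge0 : 0 <= 2 * Num.sqrt (1 / (c - 1)) by rewrite mulr_ge0// sqrtr_ge0.
have ta_ge0 : 0 <= 1 / (c - 1) by rewrite divr_ge0// subr_ge0 ltW.
have [C0 [C0_gt0 collect]] := bound_collect (F1 + 2 * RX * F2) (ler0n R n)
  cm_ge0 RX_ge0 F2_ge0 Cc_ge0 b_ge0 k_ge0 a_ge0 (sqrtr_ge0 c) ta_ge0.
pose L := 2 * F2.
have L_ge0 : 0 <= L by rewrite mulr_ge0.
(* [Creg] collects the case [N = 0], [K = L]. In [Cccv], the part [n F1] comes from the trivial
   bound on the negative regret and the rest from the case [K = N L]. *)
pose Creg := C0 * (1 + (1 + L) ^+ 2).
pose Cccv := n%:R * F1 + C0 * (2 + (2 + L) ^+ 2).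
have Creg_gt0 : 0 < Creg by rewrite mulr_gt0// ltr_pwDl// sqr_ge0.
have Cccv_gt0 : 0 < Cccv.
  by rewrite ltr_wpDl ?mulr_ge0// mulr_gt0// ltr_pwDl// sqr_ge0.
(* One constant serves both claims, and the threshold is 0 because every estimate holds from [T = 1]
   on. *)
exists (Creg + Cccv), 0%N; split; first exact: addr_gt0.
move=> x xhat z omega q run T T_gt0 _.
have T_ge1 : 1 <= T%:R :> R by rewrite ler1n.
have T_ge0 : 0 <= T%:R :> R by [].
have pow_ge1 (a : R) : 0 <= a -> 1 <= (T%:R : R) `^ a.
  by move=> a0; apply: le_trans (ler_powR T_ge1 a0); rewrite powRr0.
have dev_ge0 : 0 <= \sum_(t < T) deviation (x^~ t.+1).
  by apply: sumr_ge0 => t _; exact: deviation_ge0.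
have master y N K : 0 <= N -> 0 <= K ->
    (forall t, (0 < t)%N -> X (y t)) ->
    (forall i t, (0 < t <= T)%N -> nonpos (g i t (y t))) ->
  \sum_(t < T) \sum_i (f i t.+1 (x i t.+1) - f i t.+1 (y t.+1))
    + N * (\sum_(t < T) \sum_i enorm (pospart (g i t.+1 (x i t.+1))))
    + K * (\sum_(t < T) deviation (x^~ t.+1)) <=
  C0 * (N ^+ 2 * T%:R `^ (1 - kappa) + T%:R `^ kappa
        + T%:R `^ 2^-1 * (\sum_(t < T) enorm (y t.+2 - y t.+1))
        + (1 + N + K) ^+ 2 * T%:R `^ 2^-1).
  move=> N_ge0 K_ge0 y_in y_feas.
  have := run_bound n_gt0 Wds Xcvx Xcl X_le f_sub g_sub gpos_sub F1_ge0 F2_ge0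
    g_le df_le dg_le (alpha_gt0 c_gt1 tauE PsiE alphaE)
    (alpha_noninc c_gt1 tauE PsiE alphaE) (beta_gt0 betaE) (beta_noninc kappa01 betaE)
    (gamma_gt0 gammaE) (beta_gamma_le1 betaE gammaE)
    (gamma_step kappa01 betaE gammaE) (fun t t0 => ltW (tau_gt0 c_gt1 tauE t0))
    (tau_le1 c_gt1 tauE) run cm_ge consensus T_gt0 y_in y_feas N_ge0 K_ge0.
  move=> /le_trans; apply.
  rewrite (gammaE _ (ltn0Sn 0)) powR1 divr1 invr1.
  apply: collect => //.
  - by apply: sumr_ge0 => t _; exact: enorm_ge0.
  - by rewrite pow_ge1// subr_ge0 ltW.
  - by rewrite pow_ge1.
  - by rewrite mulrC; exact: sum_beta_le.
  - by rewrite mulrC; exact: sum_gamma_le.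
  - exact: (sum_alpha_le c_gt1 tauE PsiE alphaE).
  - have aT := alpha_gt0 c_gt1 tauE PsiE alphaE (ltn0Sn T).
    rewrite invr_ge0 mulr_ge0 ?(ltW aT)//= invfM.
    have := inv_alpha_le c_gt1 tauE PsiE alphaE (ltn0Sn T).
    (* The weight [r T] involves [alpha] at [T + 1]. From [T + 1 <= 4 T] the shift costs a factor 2,
       which the 2 in [(2 * alpha)^-1] compensates. *)
    have : T.+1%:R `^ 2^-1 <= 2 * T%:R `^ 2^-1 :> R.
      apply: (@le_trans _ _ ((4 * T%:R) `^ 2^-1)).
        by rewrite ge0_ler_powR ?nnegrE ?invr_ge0// -natr1; lra.
      by rewrite powRM// powR12_sqrt// -[4](_ : 2 ^+ 2 = _) ?sqrtr_sqr ?ger0_norm//; ring.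
    move=> /(ler_wpM2l (sqrtr_ge0 c)); lra.
  - rewrite sum_tau_le// andbT; apply: sumr_ge0 => t _.
    exact: ltW (tau_gt0 c_gt1 tauE _).
split.
- move=> y y_feas.
  have y_X t : (1 <= t <= T)%N -> X (y t) by move=> /y_feas[].
  (* [y] is constrained up to time [T] only, so it is frozen from there on. *)
  pose y' t := y (minn t T).
  have y'E t : (t <= T)%N -> y' t = y t by move=> tT; rewrite /y' (minn_idPl tT).
  have y'_in t : (0 < t)%N -> X (y' t).
    by move=> t0; apply: y_X; rewrite leq_min t0 T_gt0 geq_minr.
  have y'_feas i t : (0 < t <= T)%N -> nonpos (g i t (y' t)).
    move=> /andP[t0 tT]; rewrite y'E//.
    apply: (nonpos_mxcol (v := fun i => g i t (y t))).
    by have [] := y_feas t (introT andP (conj t0 tT)).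
  have pathE : \sum_(t < T) enorm (y' t.+2 - y' t.+1) = path_length y T.
    transitivity (\sum_(1 <= t < T.+1) enorm (y' t.+1 - y' t)).
      by rewrite big_add1 big_mkord.
    have y'S : y' T.+1 = y' T by rewrite /y' (minn_idPr (leqnSn T)) minnn.
    rewrite big_nat_recr//= y'S subrr enorm0 addr0.
    by apply: eq_big_nat => t /andP[_ tT]; rewrite !y'E// ltnW.
  have path_ge0 : 0 <= path_length y T.
    by apply: sumr_ge0 => t _; exact: enorm_ge0.
  (* [N = 0] removes the term with exponent [1 - kappa], and [K = L] matches the disagreement in
     [net_reg_le]. *)
  have := master y' 0 L (lexx _) L_ge0 y'_in y'_feas.
  rewrite pathE mul0r addr0 expr0n mul0r add0r addr0 => bound.
  have regE : net_reg f x y T = net_reg f x y' T.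
    rewrite /net_reg; congr (_ - _); rewrite !big_add1 !big_mkord.
    by apply: eq_bigr => t _; rewrite y'E.
  have reg := net_reg_le n_gt0 Xcl X_le f_sub F2_ge0 df_le run T y'.
  rewrite regE; apply: (le_trans reg).
  set S := _ + _ in bound *.
  set u := T%:R `^ kappa in bound *; set s := T%:R `^ 2^-1 in bound *.
  set M := T%:R `^ Num.max kappa (1 / 2).
  rewrite div1r -/s; set P := path_length y T in path_ge0 bound *.
  have uM : u <= M by rewrite ler_powR// le_max lexx.
  have sM : s <= M by rewrite ler_powR// le_max div1r lexx orbT.
  have s_ge0 : 0 <= s by exact: powR_ge0.
  have M_ge0 : 0 <= M by exact: powR_ge0.
  have total : S <= Creg * (M + s * P).
    apply: (le_trans bound); rewrite /Creg -mulrA ler_pM2l//.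
    have := ler_wpM2l (sqr_ge0 (1 + L)) sM.
    have := mulr_ge0 (sqr_ge0 (1 + L)) (mulr_ge0 s_ge0 path_ge0); lra.
  have rhs_ge0 : 0 <= M + s * P by rewrite addr_ge0// mulr_ge0.
  rewrite ler_pdivrMl ?ltr0n//; apply: (le_trans total).
  apply: (@le_trans _ _ ((Creg + Cccv) * (M + s * P))).
    by rewrite ler_wpM2r// lerDl ltW.
  by rewrite ler_peMl ?ler1n// mulr_ge0// ltW// addr_gt0.
(* A static comparator has path-length zero, so no path term enters the violation bound. *)
- have [y0 [y [Xy y_feas _]]] := static_feasible_neq0 T T_gt0.
  set E0 := Num.max (1 - kappa / 2) (3 / 4).
  have E_lt1 : E0 < 1 by rewrite gt_max; apply/andP; split; lra.
  have E1 : 1 - kappa / 2 <= E0 by rewrite le_max lexx.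
  have E2 : 3 / 4 <= E0 by rewrite le_max lexx orbT.
  pose N := T%:R `^ (1 - E0).
  have N_ge1 : 1 <= N by rewrite pow_ge1// subr_ge0 ltW.
  have N_gt0 : 0 < N by exact: lt_le_trans N_ge1.
  have NL_ge0 : 0 <= N * L by rewrite mulr_ge0// ltW.
  have y_in t : (0 < t)%N -> X ((fun=> y) t) by [].
  have y_feas' i t : (0 < t <= T)%N -> nonpos (g i t y).
    by move=> tT; apply: (nonpos_mxcol (v := fun i => g i t y)); exact: y_feas.
  (* [net_ccv_le] is going to be multiplied by [N], which puts the weight [N * L] on the
     disagreement. *)
  have := master (fun=> y) N (N * L) (ltW N_gt0) NL_ge0 y_in y_feas'.
  have -> : \sum_(t < T) enorm (y - y) = 0 by rewrite big1// => t _; rewrite subrr enorm0.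
  rewrite mulr0 addr0; set Sv := \sum_(t < T) \sum_i enorm _; set Sd := \sum_(t < T) deviation _.
  set Sf := \sum_(t < T) \sum_i _; set u := T%:R `^ (1 - kappa); set s := T%:R `^ 2^-1 => bound.
  have Sf_ge : - (T%:R * (n%:R * F1)) <= Sf.
    rewrite lerNl /Sf -sumrN; apply: sum_le_natmul => t.
    rewrite -sumrN; apply: sum_le_natmul => i.
    apply: le_trans (ler_norm _) _; rewrite normrN.
    apply: (fg_le i t.+1 (ltn0Sn t)).1 => //; exact: (run_in n_gt0 Xcl X_le run).
  (* This is the source of the exponents: the premise reads [E0 >= 1 - kappa / 2] for
     [a = 1 - kappa] and [E0 >= 3 / 4] for [a = 1/2]. *)
  have N2_le a : (1 - E0) + (1 - E0) + a <= 1 -> N ^+ 2 * T%:R `^ a <= T%:R.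
    move=> a1; rewrite expr2 /N -!powRD ?pnatr_eq0 -?lt0n ?T_gt0 ?implybT//.
    by rewrite -[leRHS]powRr1//; exact: ler_powR.
  have N2u : N ^+ 2 * u <= T%:R by apply: N2_le; lra.
  have N2s : N ^+ 2 * s <= T%:R by apply: N2_le; lra.
  have v_le : T%:R `^ kappa <= (T%:R : R).
    by rewrite -[leRHS]powRr1//; apply: ler_powR => //; exact: ltW.
  have NL_le : (1 + N + N * L) ^+ 2 <= (2 + L) ^+ 2 * N ^+ 2.
    have NL : 1 + N + N * L <= (2 + L) * N by lra.
    have NL0 : 0 <= 1 + N + N * L by lra.
    by rewrite -exprMn ler_pXn2r ?nnegrE// (le_trans NL0 NL).
  have ccv := net_ccv_le n_gt0 Xcl X_le g_sub gpos_sub F2_ge0 dg_le run T.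
  have TE : T%:R = N * T%:R `^ E0 :> R.
    by rewrite /N -powRD ?subrK ?powRr1// pnatr_eq0 -lt0n T_gt0 implybT.
  have total : N * net_ccv g x T <= Cccv * T%:R.
    have s_ge0 : 0 <= s by exact: powR_ge0.
    have := ler_wpM2l (ltW N_gt0) ccv; rewrite -/Sv -/Sd -/L => ccvN.
    have rate : N ^+ 2 * u + T%:R `^ kappa + (1 + N + N * L) ^+ 2 * s <=
        (2 + (2 + L) ^+ 2) * T%:R.
      have := ler_wpM2r s_ge0 NL_le; have := ler_wpM2l (sqr_ge0 (2 + L)) N2s; lra.
    have := ler_wpM2l (ltW C0_gt0) rate; rewrite /Cccv; lra.
  apply: (@le_trans _ _ (Cccv * T%:R `^ E0)).
    by rewrite -(ler_pM2l N_gt0) [leRHS]mulrCA -TE.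
  by rewrite ler_wpM2r ?powR_ge0// lerDr ltW.
Qed.
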